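(* Let $T$ be the number of triangles in $\mathcal{G}$. The triangle test (the test that rejects for large values of $T$) is asymptotically powerful if $$\limsup\lambda_0<\infty\quad\text{and}\quad\lambda_1\to\infty ;$$ or $$\liminf\lambda_0>0,\qquad \lambda_0<N/n,\qquad\text{and}\qquad \frac{\lambda_1^2}{\lambda_0}\gg 1\vee\left(\frac{\lambda_0}{\sqrt N}\right)^{2/3} .$$ When $\lambda_0$ and $\lambda_1$ are fixed, $T$ converges in distribution to a Poisson distribution with parameter $\lambda_0^3/6$ under the null hypothesis and with parameter $(\lambda_0^3+\lambda_1^3)/6$ under the alternative hypothesis. In particular, the triangle test is not asymptotically powerless if $$\limsup\lambda_0<\infty\quad\text{and}\quad\liminf\lambda_1>0 .$$
   Context: Setting. We observe an undirected simple graph $\mathcal{G}$ on the node set $\mathcal{V}=\{1,\dots,N\}$ with adjacency matrix $(W_{i,j})$ (symmetric, $0/1$, zero diagonal). Under the null hypothesis, with distribution $\mathbb{P}_0$, $\mathcal{G}$ is an Erdős–Rényi graph $\mathbb{G}(N,p_0)$, i.e. the $W_{i,j}$, $i<j$, are i.i.d. Bernoulli($p_0$). For $S\subset\mathcal{V}$ with $|S|=n$, under $\mathbb{P}_S$ the $W_{i,j}$, $i<j$, are independent with $\mathbb{P}_S(W_{i,j}=1)=p_1$ if $i,j\in S$ and $=p_0$ otherwise, where $p_1>p_0$. The alternative is the union over all $S$ with $|S|=n$ (the law of $T$ under $\mathbb{P}_S$ depends on $S$ only through $|S|=n$). The parameters $n,p_0,p_1$ may depend on $N$; all limits are as $N\to\infty$,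 with $n\to\infty$, $n/N\to0$, $n/\log N\to\infty$, $N^2p_0\to\infty$, $n^2p_1\to\infty$. Notation. $\lambda_0=Np_0$, $\lambda_1=np_1$; $a\vee b=\max(a,b)$; $a_N\gg b_N$ means $b_N=o(a_N)$. Tests. A test $\phi$ is a $\{0,1\}$-valued function of the adjacency matrix; its risk is $\gamma_N(\phi)=\mathbb{P}_0(\phi=1)+\max_{|S|=n}\mathbb{P}_S(\phi=0)$. The test that rejects for large values of a statistic $T$ is asymptotically powerful if there are critical values $t=t(N)$ (possibly depending on $p_1$) such that the risk of the test $\{T\ge t\}$ tends to $0$; it is asymptotically powerless if, for any sequence of reals $t=t(N)$, the risk of the test $\{T\ge t\}$ is at least $1$ in the limit. *)

(* Defs.v *)
From mathcomp Require Import all_boot all_order all_algebra.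
From mathcomp Require Import all_classical all_reals all_analysis.

Set Implicit Arguments.
Unset Strict Implicit.
Unset Printing Implicit Defensive.

Import Order.TTheory GRing.Theory Num.Theory.
Import numFieldNormedType.Exports.

Local Open Scope classical_set_scope.
Local Open Scope ring_scope.

Definition simple_graph (N : nat) (W : 'M[bool]_N) : bool :=
  [forall i, ~~ W i i] && [forall i, forall j, W i j == W j i].

(* Law of a random simple graph on 'I_N whose edges {i, j}, i < j, are
   independent, {i, j} being present with probability [q i j]; only the values
   of q above the diagonal matter. Matrices that are not simple graphs get no
   mass. *)
Definition graph_prob (R : realType) (N : nat) (q : 'I_N -> 'I_N -> R)
    (E : 'M[bool]_N -> bool) : R :=
  \sum_(W : 'M[bool]_N | simple_graph W && E W)
    \prod_(i < N) \prod_(j < N | (i < j)%N)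
      (if W i j then q i j else 1 - q i j).

Definition prob_null (R : realType) (N : nat) (p0 : R) :
    ('M[bool]_N -> bool) -> R :=
  graph_prob (fun _ _ => p0).

Definition prob_planted (R : realType) (N : nat) (p0 p1 : R)
    (S : {set 'I_N}) : ('M[bool]_N -> bool) -> R :=
  graph_prob (fun i j => if (i \in S) && (j \in S) then p1 else p0).

(* The default value 0 of the maximum is only reached when no set S has
   cardinality n, i.e. when N < n. *)
Definition risk (R : realType) (N n : nat) (p0 p1 : R)
    (phi : 'M[bool]_N -> bool) : R :=
  prob_null p0 phi +
  \big[Num.max/0]_(S : {set 'I_N} | #|S| == n)
    prob_planted p0 p1 S (fun W => ~~ phi W).

Definition threshold_test (R : realType) (N : nat) (T : 'M[bool]_N -> R)
    (t : R) : 'M[bool]_N -> bool :=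
  fun W => t <= T W.

Definition asymptotically_powerful (R : realType) (n : nat -> nat)
    (p0 p1 : nat -> R) (T : forall N, 'M[bool]_N -> R) : Prop :=
  exists t : nat -> R,
    risk (n N) (p0 N) (p1 N) (threshold_test (T N) (t N)) @[N --> \oo] --> 0.

Definition asymptotically_powerless (R : realType) (n : nat -> nat)
    (p0 p1 : nat -> R) (T : forall N, 'M[bool]_N -> R) : Prop :=
  forall t : nat -> R,
    (1 <= limn_einf (fun N =>
       (risk (n N) (p0 N) (p1 N) (threshold_test (T N) (t N)))%:E))%E.

Definition triangles (R : realType) (N : nat) (W : 'M[bool]_N) : R :=
  #|[set A : {set 'I_N} | (#|A| == 3)%N &&
       [forall i in A, forall j in A, (i != j) ==> W i j]]|%:R.

(* Convergence in distribution of real random variables, in terms of their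
   distribution functions. *)
Definition cdf_cvg (R : realType) (F : nat -> R -> R) (G : R -> R) : Prop :=
  forall x : R, {for x, continuous G} -> F N x @[N --> \oo] --> G x.

(* The second argument of [poisson_prob] is not used in its body. *)
Definition poisson_cdf (R : realType) (mu x : R) : R :=
  fine (poisson_prob mu 0 [set k : nat | k%:R <= x]).

(* Main.v *)
Require Import Defs.
From mathcomp Require Import all_boot all_order all_algebra.
From mathcomp Require Import all_classical all_reals all_analysis.
From mathcomp Require Import ring lra.

(* Write T for the number of triangles, mu and v for its mean and variance, and
   D for the sum, over pairs of distinct triples of nodes sharing an edge, of
   the probability that both are triangles. As disjoint edge sets are independent,
   v <= mu + D, and the null law is the planted law with S empty. Counting
   triples and pairs of triples by their position relative to S bounds mu and D
   by polynomials in lambda0, lambda1, n p0, p0 and p1.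

   Powerful regimes: Chebyshev's inequality with the threshold halfway between
   the null mean and a lower bound of the planted mean, the gap between the two
   being of order lambda1^3.

   Poisson limits: the Stein--Chen method, applied to indicators of points,
   yields |(k+1) P(T = k+1) - mu P(T = k)| <= 2 D + p1 mu. When the right-hand
   side vanishes, this recurrence determines P(T = k) up to the factor P(T = 0),
   which is fixed by the total mass thanks to Markov's inequality.

   Not powerless: where lambda1 is large Chebyshev's bound applies; where it is
   bounded, rejecting when T >= 1 has risk close to
   1 - exp(- mu_null) + exp(- mu_planted), uniformly in N. *)

Set Implicit Arguments.
Unset Strict Implicit.
Unset Printing Implicit Defensive.

Import Order.TTheory GRing.Theory Num.Theory.
Import numFieldNormedType.Exports.
Local Open Scope ring_scope.

(** * Random graphs with independent edges *)

Section GraphExpectation.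
Variables (R : realType) (N : nat) (q : 'I_N -> 'I_N -> R).
Implicit Types (W : 'M[bool]_N) (e : 'I_N * 'I_N) (F G : {set 'I_N * 'I_N}).

(** An undirected edge is represented once, by its increasing pair; these pairs index the product in
    [graph_prob]. *)
Definition edge_slot e := (e.1 < e.2)%N.

Definition graph_weight W : R :=
  \prod_(e | edge_slot e) (if W e.1 e.2 then q e.1 e.2 else 1 - q e.1 e.2).

Definition graph_exp (f : 'M[bool]_N -> R) : R :=
  \sum_(W | simple_graph W) graph_weight W * f W.

Lemma graph_probE (E : 'M[bool]_N -> bool) :
  graph_prob q E = graph_exp (fun W => (E W)%:R).
Proof.
rewrite /graph_prob big_mkcondr /=; apply: eq_bigr => W _.
rewrite pair_big_dep /= -/(graph_weight W).
by case: (E W); rewrite ?mulr1 ?mulr0.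
Qed.

Lemma simple_graphP W :
  reflect ((forall i, W i i = false) /\ (forall i j, W i j = W j i))
          (simple_graph W).
Proof.
apply: (iffP andP) => -[W0 WC].
  split=> [i|i j]; first by apply/negbTE/(forallP W0).
  by apply/eqP/(forallP (forallP WC i)).
split; first by apply/forallP => i; rewrite W0.
by apply/forallP => i; apply/forallP => j; rewrite WC.
Qed.

(** Expanding the product over the slots of the sums [q + (1 - q) = 1] gives one term per boolean
    function supported on the slots. Symmetrisation [h] and restriction [h'] match these functions
    with the simple graphs. *)
Lemma graph_exp1 : graph_exp (fun=> 1) = 1.
Proof.
pose h (f : {ffun 'I_N * 'I_N -> bool}) : 'M[bool]_N :=
  \matrix_(i, j) (f (i, j) || f (j, i)).
pose h' W := [ffun e => edge_slot e && W e.1 e.2].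
have h'K W : simple_graph W -> h (h' W) = W.
  move=> /simple_graphP[W0 WC]; apply/matrixP => i j.
  rewrite mxE !ffunE /edge_slot /= (WC j i) -andb_orl.
  have [ij|ij|/ord_inj->] := ltngtP i j => //=; by rewrite W0.
transitivity (\prod_(e | edge_slot e)
    \sum_(b : bool) (if b then q e.1 e.2 else 1 - q e.1 e.2)).
  rewrite (big_distr_big false) /graph_exp (reindex_onto h h') //.
  apply: eq_big => [f|f /andP[_ /eqP hf]].
    apply/andP/pffun_onP => [[_ /eqP <-]|[fsupp _]].
      split=> //; apply/fintype.subsetP => e; rewrite supportE ffunE.
      by rewrite eqbF_neg negbK => /andP[].
    have f0 e : ~~ edge_slot e -> f e = false.
      move=> He; apply/negbTE; apply: contra He => fe.
      by move/fintype.subsetP: fsupp; apply; rewrite supportE fe.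
    split; first apply/simple_graphP; first split=> [i|i j].
    - by rewrite mxE f0 // /edge_slot /= ltnn.
    - by rewrite !mxE orbC.
    apply/eqP/ffunP => -[i j]; rewrite ffunE mxE /=.
    case: (boolP (edge_slot (i, j))) => [lij|/f0-> //].
    rewrite /= (f0 (j, i)) ?orbF //; move: lij; rewrite /edge_slot /=.
    by rewrite -leqNgt => /ltnW.
  rewrite mulr1; apply: eq_bigr => e le; congr (if _ then _ else _).
  by rewrite -[in RHS]hf ffunE le.
by apply: big1 => e _; rewrite big_bool /= addrC subrK.
Qed.

Lemma graph_exp_ext f g : (forall W, simple_graph W -> f W = g W) ->
  graph_exp f = graph_exp g.
Proof. by move=> fg; apply: eq_bigr => W /fg->. Qed.

Lemma graph_expD f g :
  graph_exp (fun W => f W + g W) = graph_exp f + graph_exp g.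
Proof. by rewrite -big_split; apply: eq_bigr => W _; rewrite mulrDr. Qed.

Lemma graph_expZ c f : graph_exp (fun W => c * f W) = c * graph_exp f.
Proof. by rewrite /graph_exp mulr_sumr; apply: eq_bigr => W _; rewrite mulrCA. Qed.

Lemma graph_expB f g :
  graph_exp (fun W => f W - g W) = graph_exp f - graph_exp g.
Proof. by rewrite -sumrB; apply: eq_bigr => W _; rewrite mulrBr. Qed.

Lemma graph_exp_cst c : graph_exp (fun=> c) = c.
Proof.
rewrite -[RHS]mulr1 -graph_exp1 -graph_expZ.
by apply: graph_exp_ext => W _; rewrite mulr1.
Qed.

Lemma graph_exp_sum (I : finType) (P : pred I) (f : I -> 'M[bool]_N -> R) :
  graph_exp (fun W => \sum_(i | P i) f i W) = \sum_(i | P i) graph_exp (f i).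
Proof. by rewrite exchange_big /=; apply: eq_bigr => W _; rewrite mulr_sumr. Qed.

(** Both the entry at [e] and its mirror image are toggled, so that symmetry is kept. Invariance
    under this involution expresses that a function does not depend on [e]. *)
Definition flip_edge e W : 'M[bool]_N :=
  \matrix_(i, j) (W i j (+) (((i, j) == e) || ((j, i) == e))).

Lemma flip_edgeK e : involutive (flip_edge e).
Proof. by move=> W; apply/matrixP => i j; rewrite !mxE -addbA addbb addbF. Qed.

Lemma simple_flip_edge e W : edge_slot e ->
  simple_graph (flip_edge e W) = simple_graph W.
Proof.
move=> le; suff H V : simple_graph V -> simple_graph (flip_edge e V).
  by apply/idP/idP => [/H|/H //]; rewrite flip_edgeK.
move=> /simple_graphP[V0 VC]; apply/simple_graphP; split=> [i|i j]; rewrite !mxE.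
  rewrite V0 orbb addFb; apply/negbTE/eqP => ie.
  by move: le; rewrite -ie /edge_slot ltnn.
by rewrite VC orbC.
Qed.

Lemma flip_edgeE e e' W : edge_slot e -> edge_slot e' ->
  flip_edge e W e'.1 e'.2 = addb (W e'.1 e'.2) (e' == e).
Proof.
case: e e' => i j [k l]; rewrite /edge_slot mxE /= => ij kl; congr addb.
rewrite -[in RHS](orbF (_ == _)); congr (_ || _).
apply/negbTE/eqP => -[lk ji]; move: ij; rewrite -lk -ji.
by rewrite ltnNge ltnW.
Qed.

(** Each graph containing [e] is paired with its flip. The two weights are [q] and [1 - q] times a
    common factor [r], and [f] takes the same value on both graphs. *)
Lemma graph_exp_edge e f : edge_slot e ->
  (forall W, f (flip_edge e W) = f W) ->
  graph_exp (fun W => (W e.1 e.2)%:R * f W) = q e.1 e.2 * graph_exp f.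
Proof.
move=> le fe.
pose r W := \prod_(e' | edge_slot e' && (e' != e))
  (if W e'.1 e'.2 then q e'.1 e'.2 else 1 - q e'.1 e'.2).
have wE W : graph_weight W =
    (if W e.1 e.2 then q e.1 e.2 else 1 - q e.1 e.2) * r W.
  by rewrite /graph_weight (bigD1 e).
have rF W : r (flip_edge e W) = r W.
  by apply: eq_bigr => e' /andP[le' /negbTE ne]; rewrite flip_edgeE // ne addbF.
have splitE g : graph_exp g = \sum_(W | simple_graph W && W e.1 e.2)
    r W * (q e.1 e.2 * g W + (1 - q e.1 e.2) * g (flip_edge e W)).
  rewrite /graph_exp (bigID (fun W : 'M[bool]_N => W e.1 e.2)) /=.
  rewrite [X in _ + X](reindex_inj (inv_inj (flip_edgeK e))) /=.
  rewrite [X in _ + X](eq_bigl (fun W => simple_graph W && W e.1 e.2)).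
    rewrite -big_split; apply: eq_bigr => W /andP[_ We] /=.
    by rewrite !wE rF flip_edgeE // We eqxx /=; ring.
  by move=> W; rewrite simple_flip_edge // flip_edgeE // eqxx addbT negbK.
rewrite !splitE mulr_sumr; apply: eq_bigr => W /andP[_ We].
rewrite !fe flip_edgeE // We eqxx /=; ring.
Qed.

Definition all_edges F W := [forall e in F, W e.1 e.2].

Lemma all_edgesU F G W : all_edges (F :|: G) W = all_edges F W && all_edges G W.
Proof.
apply/forall_inP/andP => [H|[/forall_inP HF /forall_inP HG] e].
  by split; apply/forall_inP => e eF; apply: H; rewrite inE eF ?orbT.
by rewrite inE => /orP[/HF|/HG].
Qed.

Lemma all_edges1 e W : all_edges [set e] W = W e.1 e.2.
Proof.
apply/forall_inP/idP => [H|We e']; first by apply: H; rewrite inE.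
by rewrite inE => /eqP->.
Qed.

Definition edge_slots F := {in F, forall e, edge_slot e}.

Lemma all_edges_flip F e W : edge_slots F -> edge_slot e -> e \notin F ->
  all_edges F (flip_edge e W) = all_edges F W.
Proof.
move=> sF le eF; apply: eq_forallb_in => e' e'F.
rewrite flip_edgeE ?(sF e') //; have [ee|ne] := eqVneq e' e.
  by rewrite -ee e'F in eF.
by rewrite addbF.
Qed.

(** Independence of disjoint edge sets. The edges of [F] are peeled off one at a time: [f] times the
    indicator of the remaining edges does not depend on the edge removed. *)
Lemma graph_exp_edges F f : edge_slots F ->
  (forall e W, e \in F -> f (flip_edge e W) = f W) ->
  graph_exp (fun W => (all_edges F W)%:R * f W) =
  (\prod_(e in F) q e.1 e.2) * graph_exp f.
Proof.
move: {2}#|F| (erefl #|F|) => k; elim: k F => [|k IH] F.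
  move=> /eqP; rewrite cards_eq0 => /eqP-> _ _; rewrite big_set0 mul1r.
  apply: graph_exp_ext => W _; rewrite (_ : all_edges _ _ = true) ?mul1r //.
  by apply/forall_inP => e; rewrite inE.
move=> cF sF fF; have /set0Pn[e eF] : F != finset.set0.
  by rewrite -card_gt0 cF.
rewrite (big_setD1 e) //= -mulrA -IH; first last.
- by move=> e' W /setD1P[_ e'F]; rewrite fF.
- by move=> e' /setD1P[_ /sF].
- by move: cF; rewrite (cardsD1 e) eF => -[].
rewrite -graph_exp_edge ?(sF e) //; last first.
  move=> W; rewrite fF // all_edges_flip ?(sF e) //; last by rewrite !inE eqxx.
  by move=> e' /setD1P[_ /sF].
apply: graph_exp_ext => W _; rewrite -{1}(finset.setD1K eF) all_edgesU all_edges1.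
by rewrite -mulnb natrM mulrA.
Qed.

Lemma graph_exp_all_edges F : edge_slots F ->
  graph_exp (fun W => (all_edges F W)%:R) = \prod_(e in F) q e.1 e.2.
Proof.
move=> sF; rewrite -[RHS]mulr1 -[X in _ * X]graph_exp1 -graph_exp_edges //.
by apply: graph_exp_ext => W _; rewrite mulr1.
Qed.

Hypothesis q01 : forall e, edge_slot e -> 0 <= q e.1 e.2 <= 1.

Lemma graph_weight_ge0 W : 0 <= graph_weight W.
Proof.
by apply: prodr_ge0 => e /q01 /andP[q0 q1]; case: ifP; rewrite ?subr_ge0.
Qed.

Lemma ler_graph_exp f g : (forall W, simple_graph W -> f W <= g W) ->
  graph_exp f <= graph_exp g.
Proof.
by move=> fg; apply: ler_sum => W sW; rewrite ler_wpM2l ?graph_weight_ge0 ?fg.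
Qed.

Lemma graph_exp_ge0 f : (forall W, simple_graph W -> 0 <= f W) ->
  0 <= graph_exp f.
Proof. by move=> f0; rewrite -[0](graph_exp_cst 0); exact: ler_graph_exp. Qed.

Lemma ler_norm_graph_exp f : `|graph_exp f| <= graph_exp (fun W => `|f W|).
Proof.
apply: le_trans (ler_norm_sum _ _ _) _; apply: ler_sum => W _.
by rewrite normrM ger0_norm ?graph_weight_ge0.
Qed.

End GraphExpectation.

(** * Counting the present members of a family of edge sets: variance and Stein--Chen bound *)

Section SubgraphCount.
Variables (R : realType) (N : nat) (q : 'I_N -> 'I_N -> R).
Hypothesis q01 : forall e, edge_slot e -> 0 <= q e.1 e.2 <= 1.
Variables (I : finType) (P : pred I) (F : I -> {set 'I_N * 'I_N}).
Hypothesis F_slots : forall i, P i -> edge_slots (F i).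
Hypothesis F_neq0 : forall i, P i -> F i != finset.set0.

Definition subgraph_count (W : 'M[bool]_N) : nat :=
  (\sum_(i | P i) all_edges (F i) W)%N.

Definition edges_prob (E : {set 'I_N * 'I_N}) : R := \prod_(e in E) q e.1 e.2.

Definition mean_count : R := \sum_(i | P i) edges_prob (F i).

Definition dependent_at i : pred I :=
  fun j => [&& P j, j != i & ~~ [disjoint F i & F j]].

(** The quantity D of the overview, as a sum over ordered pairs. *)
Definition dependence : R :=
  \sum_(i | P i) \sum_(j | dependent_at i j) edges_prob (F i :|: F j).

Local Notation pres i W := (all_edges (F i) W).
Local Notation T := subgraph_count.
Local Notation mu := mean_count.
Local Notation Ex := (graph_exp q).

Lemma edges_prob_ge0 E : edge_slots E -> 0 <= edges_prob E.
Proof. by move=> sE; apply: prodr_ge0 => e /sE /q01 /andP[]. Qed.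

Lemma edges_prob_le (E E' : {set 'I_N * 'I_N}) : edge_slots E -> E' \subset E ->
  edges_prob E <= edges_prob E'.
Proof.
move=> sE EE'; rewrite /edges_prob (big_setID E') /= (finset.setIidPr EE').
rewrite -[leRHS]mulr1; apply: ler_wpM2l.
  by apply: edges_prob_ge0 => e /(fintype.subsetP EE') /sE.
by apply: numdomain.Num.Theory.prodr_ile1 => e /setDP[/sE /q01].
Qed.

Lemma edges_probU (E E' : {set 'I_N * 'I_N}) :
  edges_prob (E :|: E') = edges_prob E * edges_prob (E' :\: E).
Proof.
rewrite [LHS](big_setID E) /= finset.setUK.
by rewrite finset.setDUl finset.setDv finset.set0U.
Qed.

Lemma edges_probU_disjoint (E E' : {set 'I_N * 'I_N}) : [disjoint E & E'] ->
  edges_prob (E :|: E') = edges_prob E * edges_prob E'.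
Proof.
by rewrite disjoint_sym edges_probU => /finset.setDidPl->.
Qed.

(** Presence events are positively correlated: the product on the left counts each common edge
    twice, with factors at most 1. *)
Lemma edges_probU_ge (E E' : {set 'I_N * 'I_N}) :
  edge_slots E -> edge_slots E' ->
  edges_prob E * edges_prob E' <= edges_prob (E :|: E').
Proof.
move=> sE sE'; rewrite edges_probU.
by rewrite ler_wpM2l ?edges_prob_ge0 // edges_prob_le // finset.subsetDl.
Qed.

Lemma mean_count_ge0 : 0 <= mu.
Proof. by apply: sumr_ge0 => i /F_slots; exact: edges_prob_ge0. Qed.

Lemma exp_edges i : P i -> Ex (fun W => (pres i W)%:R) = edges_prob (F i).
Proof. by move=> Pi; rewrite graph_exp_all_edges //; apply: F_slots. Qed.

Lemma exp_edges2 i j : P i -> P j ->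
  Ex (fun W => (pres i W)%:R * (pres j W)%:R) = edges_prob (F i :|: F j).
Proof.
move=> Pi Pj; rewrite -[RHS]graph_exp_all_edges.
  by apply: graph_exp_ext => W _; rewrite all_edgesU -mulnb natrM.
by move=> e /setUP[]; apply: F_slots.
Qed.

Lemma exp_count : Ex (fun W => (T W)%:R) = mu.
Proof.
rewrite -[mu](eq_bigr _ exp_edges) -graph_exp_sum.
by apply: graph_exp_ext => W _; rewrite natr_sum.
Qed.

(** The variance is the sum of all covariances. Those of edge-disjoint members vanish, the others
    are at most the joint probabilities, and the diagonal contributes at most [mu]. *)
Lemma var_count_le : Ex (fun W => ((T W)%:R - mu) ^+ 2) <= mu + dependence.
Proof.
have -> : Ex (fun W => ((T W)%:R - mu) ^+ 2) =
    \sum_(i | P i) \sum_(j | P j)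
      (edges_prob (F i :|: F j) - edges_prob (F i) * edges_prob (F j)).
  under [RHS]eq_bigr do rewrite sumrB.
  rewrite sumrB -big_distrlr /= -/mu.
  transitivity (Ex (fun W => (T W)%:R * (T W)%:R
      + ((- 2 * mu) * (T W)%:R + mu ^+ 2))).
    by apply: graph_exp_ext => W _; ring.
  rewrite !graph_expD graph_expZ graph_exp_cst exp_count.
  suff -> : Ex (fun W => (T W)%:R * (T W)%:R) =
     \sum_(i | P i) \sum_(j | P j) edges_prob (F i :|: F j) by ring.
  rewrite (eq_bigr (fun i =>
      Ex (fun W => \sum_(j | P j) (pres i W)%:R * (pres j W)%:R))).
    rewrite -graph_exp_sum; apply: graph_exp_ext => W _.
    by rewrite natr_sum -big_distrlr.
  move=> i Pi; rewrite graph_exp_sum; apply: eq_bigr => j Pj.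
  by rewrite exp_edges2.
rewrite -big_split; apply: ler_sum => i Pi /=.
rewrite (bigD1 i) //= lerD //.
  rewrite finset.setUid lerBlDr lerDl mulr_ge0 // edges_prob_ge0 //;
  exact: F_slots.
rewrite [leLHS](bigID (fun j => [disjoint F i & F j])) /=.
rewrite [X in X + _]big1 ?add0r => [|j /andP[/andP[Pj _] dij]]; last first.
  by rewrite edges_probU_disjoint // subrr.
rewrite [leRHS](eq_bigl
  (fun j => (P j && (j != i)) && ~~ [disjoint F i & F j])); last first.
  by move=> j; rewrite /dependent_at andbA.
apply: ler_sum => j /andP[/andP[Pj _] _]; rewrite lerBlDr lerDl mulr_ge0 //.
  exact/edges_prob_ge0/F_slots.
exact/edges_prob_ge0/F_slots.
Qed.

(* The Stein--Chen argument with the indicator of [k.+1] as test function. *)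
Lemma stein_chen_count k :
  `|k.+1%:R * Ex (fun W => (T W == k.+1)%:R) - mu * Ex (fun W => (T W == k)%:R)|
  <= 2 * dependence + \sum_(i | P i) edges_prob (F i) ^+ 2.
Proof.
(* On the event [T = k.+1] the factor [k.+1] is [T] itself, a sum of indicators. *)
have -> : k.+1%:R * Ex (fun W => (T W == k.+1)%:R) =
    \sum_(i | P i) Ex (fun W => (pres i W)%:R * (T W == k.+1)%:R).
  rewrite -graph_exp_sum -graph_expZ; apply: graph_exp_ext => W _.
  rewrite -mulr_suml -natr_sum -/(T W).
  by have [->//|] := eqVneq; rewrite !mulr0.
rewrite mulr_suml -sumrB mulr_sumr -big_split /=.
apply: le_trans (ler_norm_sum _ _ _) _; apply: ler_sum => i Pi.
(* [V] counts the members edge-disjoint from [F i], hence independent of its presence; [U] counts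
   the other members that meet [F i]. *)
pose V W := (\sum_(j | P j && [disjoint F i & F j]) pres j W)%N.
pose U W := (\sum_(j | dependent_at i j) pres j W)%N.
have TE W : T W = (V W + U W + pres i W)%N.
  rewrite /T (bigID (fun j => [disjoint F i & F j])) /= -addnA.
  congr (V W + _)%N.
  rewrite (bigD1 i) /=; last first.
    by rewrite Pi -setI_eq0 finset.setIid F_neq0.
  rewrite addnC; congr addn; apply: eq_bigl => j; rewrite /dependent_at.
  by rewrite -andbA [in LHS](andbC (~~ _)).
have EV : Ex (fun W => (pres i W)%:R * (V W == k)%:R) =
    edges_prob (F i) * Ex (fun W => (V W == k)%:R).
  apply: graph_exp_edges; first exact: F_slots.
  move=> e W eFi; congr (_ == _)%:R; apply: eq_bigr => j /andP[Pj dij].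
  rewrite all_edges_flip //; first exact: F_slots.
  - by apply: (F_slots Pi).
  - by rewrite (disjointFr dij).
have EXU : Ex (fun W => (pres i W)%:R * (U W)%:R) =
    \sum_(j | dependent_at i j) edges_prob (F i :|: F j).
  rewrite (eq_bigr (fun j => Ex (fun W => (pres i W)%:R * (pres j W)%:R))).
    rewrite -graph_exp_sum; apply: graph_exp_ext => W _.
    by rewrite natr_sum mulr_sumr.
  by move=> j /and3P[Pj _ _]; rewrite exp_edges2.
have EU : Ex (fun W => (U W)%:R) = \sum_(j | dependent_at i j) edges_prob (F j).
  rewrite (eq_bigr (fun j => Ex (fun W => (pres j W)%:R))).
    by rewrite -graph_exp_sum; apply: graph_exp_ext => W _; rewrite natr_sum.
  by move=> j /and3P[Pj _ _]; rewrite exp_edges.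
have pi0 : 0 <= edges_prob (F i) by exact/edges_prob_ge0/F_slots.
(* The indicator of [V = k] is inserted between the two terms; by [EV] its contributions cancel. *)
have -> : Ex (fun W => (pres i W)%:R * (T W == k.+1)%:R) -
      edges_prob (F i) * Ex (fun W => (T W == k)%:R) =
    Ex (fun W => (pres i W)%:R * ((T W == k.+1)%:R - (V W == k)%:R)) +
    edges_prob (F i) * Ex (fun W => (V W == k)%:R - (T W == k)%:R).
  rewrite graph_expB mulrBr -EV addrA; congr (_ - _).
  by rewrite -graph_expD; apply: graph_exp_ext => W _; rewrite mulrBr subrK.
apply: le_trans (ler_normD _ _) _.
rewrite mulr2n mulrDl mul1r -addrA; apply: lerD.
  (* When [F i] is present, [T = V + U + 1], so the two indicators differ only if [U >= 1], and
     their difference is at most [U]. *)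
  apply: le_trans (ler_norm_graph_exp q01 _) _; rewrite -EXU.
  apply: ler_graph_exp => // W _; rewrite TE.
  case: (pres i W); rewrite ?mul0r ?normr0 // !mul1r addn1 eqSS.
  case: (U W) => [|u]; first by rewrite addn0 subrr normr0.
  apply: (@le_trans _ _ 1); last by rewrite ler1n.
  by do 2!case: eqP => _; rewrite ?subrr ?subr0 ?sub0r ?normrN ?normr0 ?normr1 ?ler01.
(* Here the indicators differ only if [F i] or one of the members counted by [U] is present. *)
rewrite normrM ger0_norm // (@le_trans _ _ (edges_prob (F i) *
   Ex (fun W => (U W)%:R + (pres i W)%:R))) //.
  apply: ler_wpM2l => //; apply: le_trans (ler_norm_graph_exp q01 _) _.
  apply: ler_graph_exp => // W _; rewrite TE -addnA -natrD.
  case: (U W + pres i W)%N => [|u]; first by rewrite addn0 subrr normr0.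
  apply: (@le_trans _ _ 1); last by rewrite ler1n.
  by do 2!case: eqP => _; rewrite ?subrr ?subr0 ?sub0r ?normrN ?normr0 ?normr1 ?ler01.
(* Positive correlation turns the products of probabilities into joint ones: this is the second copy
   of the dependence term, the presence of [F i] itself giving the square. *)
rewrite graph_expD EU exp_edges // mulrDr -expr2 lerD2r mulr_sumr.
apply: ler_sum => j /and3P[Pj _ _]; apply: edges_probU_ge; exact: F_slots.
Qed.

End SubgraphCount.

(** * Moments of the number of triangles *)

(** Overcounting: each [i] is charged to one element of its fibre under [h], and the rest of the
    fibre is nonnegative. It allows sums over sets of nodes to be bounded by sums over tuples. *)
Lemma ler_sum_surj (R : realDomainType) (I J : finType) (P : pred I)
    (Q : pred J) (h : J -> I) (G : I -> R) (H : J -> R) :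
  (forall j, Q j -> 0 <= H j) ->
  (forall i, P i -> exists j, [/\ Q j, h j = i & G i <= H j]) ->
  \sum_(i | P i) G i <= \sum_(j | Q j) H j.
Proof.
move=> H0 PQ; rewrite [leRHS](partition_big h predT) //= [leLHS]big_mkcond.
apply: ler_sum => i _; case: ifP => [/PQ[j [Qj hj Gi]]|_].
  rewrite (bigD1 j) ?Qj ?hj ?eqxx //= (le_trans Gi) // lerDl.
  by apply: sumr_ge0 => k /andP[/andP[/H0]].
by apply: sumr_ge0 => j /andP[/H0].
Qed.

(** * Triangles as a family of edge sets *)

Section Triangles.
Variable N : nat.
Implicit Types (A B S : {set 'I_N}) (i j k l : 'I_N).

Definition clique_edges A : {set 'I_N * 'I_N} :=
  [set e : 'I_N * 'I_N | [&& edge_slot e, e.1 \in A & e.2 \in A]].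

Definition is_triple : pred {set 'I_N} := fun A => (#|A| == 3)%N.

Lemma clique_edges_slots A : edge_slots (clique_edges A).
Proof. by move=> e; rewrite inE => /andP[]. Qed.

Definition slot i j := if (i < j)%N then (i, j) else (j, i).

Lemma edge_slot_slot i j : i != j -> edge_slot (slot i j).
Proof.
move=> ij; rewrite /slot /edge_slot; case: ifP => //= /negbT.
by rewrite -leqNgt leq_eqVlt => /orP[/eqP/val_inj ji|//]; rewrite ji eqxx in ij.
Qed.

Lemma slot_eq i j k l :
  (slot i j == slot k l) = ((i == k) && (j == l)) || ((i == l) && (j == k)).
Proof.
rewrite /slot; apply/eqP/orP => [|[]/andP[/eqP-> /eqP->]] //; last first.
  case: ltngtP => // kl; congr pair; first exact: val_inj.
  by apply: val_inj.
by case: ifP => _; case: ifP => _ [-> ->]; rewrite !eqxx; [left|right|right|left].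
Qed.

Lemma slot_in_clique i j A : i != j -> i \in A -> j \in A ->
  slot i j \in clique_edges A.
Proof.
move=> ij iA jA; rewrite inE edge_slot_slot //= /slot.
by case: ifP => _; rewrite iA jA.
Qed.

Lemma tripleP A : is_triple A -> exists i j k,
  [/\ i != j, i != k, j != k & A = [set i; j; k]].
Proof.
rewrite /is_triple; have [[|i [|j [|k []]]]//=] := cards_eqP.
rewrite !inE andbT negb_or -andbA => /and3P[ij ik jk] _.
by exists i, j, k; split=> //; apply/setP => x; rewrite !inE orbA.
Qed.

Lemma clique_edges_triple i j k : i != j -> i != k -> j != k ->
  clique_edges [set i; j; k] = [set slot i j; slot i k; slot j k].
Proof.
move=> ij ik jk; apply/setP => -[x y]; apply/idP/idP; last first.
  by move=> /setUP[/setUP[]|] /set1P->;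
    apply: slot_in_clique; rewrite // !inE eqxx ?orbT.
rewrite !inE /edge_slot /= => /and3P[xy xA yA].
have -> : (x, y) = slot x y by rewrite /slot xy.
rewrite !slot_eq; have : x != y by rewrite neq_ltn xy.
move: xA yA; rewrite -!orbA => /or3P[]/eqP-> /or3P[]/eqP->;
  by rewrite !eqxx ?orbT.
Qed.

Lemma card_clique_edges A : is_triple A -> #|clique_edges A| = 3%N.
Proof.
move=> /tripleP[i [j [k [ij ik jk ->]]]]; rewrite clique_edges_triple //.
rewrite -finset.setUA cardsU1 cards2 !inE !slot_eq !eqxx.
rewrite (negbTE ij) (negbTE ik) (negbTE jk) eq_sym (negbTE ij).
by rewrite ?andbF ?andFb ?orbF.
Qed.

Lemma clique_edges_neq0 A : is_triple A -> clique_edges A != finset.set0.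
Proof. by move=> /card_clique_edges cA; rewrite -card_gt0 cA. Qed.

(** [triangles] inspects both orientations of each pair, [clique_edges] only the increasing one; the
    symmetry of [W] reconciles them. *)
Lemma trianglesE (R : realType) (W : 'M[bool]_N) : simple_graph W ->
  triangles R W = (subgraph_count is_triple clique_edges W)%:R.
Proof.
move=> /simple_graphP[_ WC]; congr _%:R; rewrite -sum1_card big_mkcond /=.
rewrite /subgraph_count [RHS]big_mkcond; apply: eq_bigr => A _.
rewrite unfold_in asboolb /is_triple; case: (#|A| == 3)%N => //=.
suff -> : [forall i in A, forall j in A, (i != j) ==> W i j] =
   all_edges (clique_edges A) W by case: all_edges.
apply/forall_inP/forall_inP => [H e|H i iA].
  rewrite inE => /and3P[le /H /forall_inP He /He /implyP]; apply.
  by rewrite neq_ltn; apply/orP; left.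
apply/forall_inP => j jA; apply/implyP => ij.
have := H _ (slot_in_clique ij iA jA); rewrite /slot.
by case: ifP => _ //=; rewrite WC.
Qed.

End Triangles.

(** * Mean and dependence of the triangle count under the planted law *)

Section PlantedMoments.
Variables (R : realType) (N : nat) (p0 p1 : R) (S : {set 'I_N}).
Hypotheses (p0_ge0 : 0 <= p0) (p01 : p0 <= p1) (p1_le1 : p1 <= 1).

Definition planted_edge (i j : 'I_N) : R :=
  if (i \in S) && (j \in S) then p1 else p0.

Local Notation q := planted_edge.

Lemma planted_edge_ge0 i j : 0 <= q i j.
Proof. by rewrite /q; case: ifP => _; rewrite ?(le_trans p0_ge0). Qed.

Lemma planted_edge01 (e : 'I_N * 'I_N) : edge_slot e -> 0 <= q e.1 e.2 <= 1.
Proof.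
by move=> _; rewrite planted_edge_ge0 /q; case: ifP => _; rewrite ?(le_trans p01).
Qed.

Lemma planted_edge_slot i j : q (slot i j).1 (slot i j).2 = q i j.
Proof. by rewrite /slot; case: ifP => //= _; rewrite /q andbC. Qed.

(** Forgetting edges can only increase the probability; an explicit list of slots then makes the
    product computable. *)
Lemma planted_prob_le (E : {set 'I_N * 'I_N}) (s : seq ('I_N * 'I_N)) :
  edge_slots E -> uniq s -> {subset s <= E} ->
  edges_prob q E <= \prod_(e <- s) q e.1 e.2.
Proof.
move=> sE us sub; rewrite big_uniq //=.
have -> : \prod_(e in s) q e.1 e.2 = edges_prob q (finset (mem s)).
  by apply: eq_bigl => e; rewrite inE.
apply: edges_prob_le => //; first exact: planted_edge01.
by apply/fintype.subsetP => e; rewrite inE => /sub.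
Qed.

Definition triangle_mean : R := mean_count q (@is_triple N) (@clique_edges N).
Definition triangle_dependence : R :=
  dependence q (@is_triple N) (@clique_edges N).

(** Two distinct triples sharing the edge [ij] are [ijk] and [ijl] with [k] different from [l], and
    their union has five edges. Expanding the square sums the corresponding products over all [i],
    [j], [k], [l]. *)
Lemma triangle_dependence_le_sum : triangle_dependence <=
  \sum_i \sum_j q i j * (\sum_k q i k * q j k) ^+ 2.
Proof.
rewrite /triangle_dependence /dependence pair_big_dep /=.
(* With [t] standing for [((i, j), (k, l))], this is the product over the five edges, and [h] below
   recovers the two triples. *)
pose H (t : ('I_N * 'I_N) * ('I_N * 'I_N)) :=
  q t.1.1 t.1.2 * ((q t.1.1 t.2.1 * q t.1.2 t.2.1) *
                   (q t.1.1 t.2.2 * q t.1.2 t.2.2)).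
have -> : \sum_i \sum_j q i j * (\sum_k q i k * q j k) ^+ 2 = \sum_t H t.
  rewrite [RHS](eq_bigr (fun t => H (t.1, t.2))) => [|[]] //.
  rewrite -(pair_bigA _ (fun a b => H (a, b))) [LHS]pair_bigA /=.
  apply: eq_bigr => a _; rewrite expr2 big_distrlr /= mulr_sumr.
  rewrite -(pair_bigA _ (fun k l => H (a, (k, l)))) /=.
  by apply: eq_bigr => k _; rewrite mulr_sumr.
pose h (t : ('I_N * 'I_N) * ('I_N * 'I_N)) :=
  ([set t.1.1; t.1.2; t.2.1], [set t.1.1; t.1.2; t.2.2]).
apply: (ler_sum_surj (h := h)) => [t _|[A B] /= /andP[tA /and3P[tB neAB]]].
  by rewrite !mulr_ge0 ?planted_edge_ge0.
rewrite -setI_eq0 => /set0Pn[[i j]].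
rewrite !inE => /andP[/and3P[ij iA jA] /and3P[_ iB jB]].
have ij' : i != j by rewrite neq_ltn; apply/orP; left.
have ji : j != i by rewrite eq_sym.
have third (C : {set 'I_N}) : is_triple C -> i \in C -> j \in C ->
    exists k, [/\ k != i, k != j & C = [set i; j; k]].
  rewrite /is_triple (cardsD1 i) => + iC jC; rewrite iC (cardsD1 j (C :\ i)).
  rewrite !inE jC ji /= => /cards1P[k Ck]; exists k.
  have : k \in (C :\ i) :\ j by rewrite Ck inE.
  rewrite !inE => /and3P[kj ki _]; split=> //.
  rewrite -[LHS](finset.setD1K iC) -(finset.setD1K (a := j) (A := C :\ i)).
    by rewrite Ck finset.setUA.
  by rewrite !inE jC ji.
have [k [ki kj defA]] := third A tA iA jA.
have [l [li lj defB]] := third B tB iB jB.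
have kl : k != l by apply: contra neAB => /eqP kl; rewrite defA defB kl.
exists ((i, j), (k, l)); split=> //; first by rewrite /h /= -defA -defB.
have -> : H ((i, j), (k, l)) = \prod_(e <- [:: slot i j; slot i k; slot j k;
    slot i l; slot j l]) q e.1 e.2.
  by rewrite !big_cons big_nil !planted_edge_slot /H /= mulr1 !mulrA.
have kA : k \in A by rewrite defA !inE eqxx orbT.
have lB : l \in B by rewrite defB !inE eqxx orbT.
apply: planted_prob_le.
- by move=> e /setUP[]; apply: clique_edges_slots.
- rewrite /= !inE !slot_eq !eqxx.
  rewrite (eq_sym i k) (eq_sym i l) (eq_sym j k) (eq_sym j l) (eq_sym j i).
  rewrite (negbTE ij') (negbTE ki) (negbTE kj) (negbTE li) (negbTE lj).
  by rewrite (negbTE kl) ?(andbF, andFb, orbF).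
- have ik : i != k by rewrite eq_sym.
  have jk : j != k by rewrite eq_sym.
  have il : i != l by rewrite eq_sym.
  have jl : j != l by rewrite eq_sym.
  have sub : {subset [:: slot i j; slot i k; slot j k] <= clique_edges A}.
    by apply/allP; rewrite /= !slot_in_clique.
  have sub' : {subset [:: slot i l; slot j l] <= clique_edges B}.
    by apply/allP; rewrite /= !slot_in_clique.
  move=> e; rewrite -[_ :: _]/([:: slot i j; slot i k; slot j k] ++ _) mem_cat.
  by rewrite finset.in_setU => /orP[/sub->|/sub'->]; rewrite ?orbT.
Qed.


Local Notation n := (#|S|%:R : R).

Lemma sum_in_S : \sum_i (i \in S)%:R = n.
Proof.
rewrite -sum1_card natr_sum [RHS]big_mkcond.
by apply: eq_bigr => i _; case: ifP.
Qed.

Lemma sum_affine_in_S (u v : R) :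
  \sum_i (u + v * (i \in S)%:R) = N%:R * u + v * n.
Proof.
by rewrite big_split sumr_const card_ord -mulr_sumr sum_in_S mulr_natl.
Qed.

Lemma sum_sum_in_S (a b c : R) :
  \sum_i \sum_j (a + b * ((i \in S)%:R + (j \in S)%:R)
    + c * ((i \in S)%:R * (j \in S)%:R)) =
  N%:R ^+ 2 * a + 2 * N%:R * n * b + n ^+ 2 * c.
Proof.
rewrite (eq_bigr (fun i => (N%:R * a + b * n)
    + (N%:R * b + c * n) * (i \in S)%:R)) => [|i _].
  by rewrite sum_affine_in_S; ring.
rewrite (eq_bigr (fun j => (a + b * (i \in S)%:R)
    + (b + c * (i \in S)%:R) * (j \in S)%:R)) => [|j _]; last by ring.
by rewrite sum_affine_in_S; ring.
Qed.

(** A node [k] outside [S] contributes [p0 ^+ 2]. A node inside contributes [p0 ^+ 2], [p0 * p1] or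
    [p1 ^+ 2] according to how many of [i] and [j] lie in [S]. *)
Lemma sum_common_neighbours i j : \sum_k q i k * q j k <=
  N%:R * p0 ^+ 2 + n * p0 * p1 * ((i \in S)%:R + (j \in S)%:R)
  + n * p1 ^+ 2 * ((i \in S)%:R * (j \in S)%:R).
Proof.
pose si : R := (i \in S)%:R; pose sj : R := (j \in S)%:R.
apply: (@le_trans _ _ (\sum_k (p0 ^+ 2 +
  (p0 * p1 * (si + sj) + p1 ^+ 2 * (si * sj)) * (k \in S)%:R))).
  apply: ler_sum => k _; rewrite /q /si /sj.
  have p1_ge0 : 0 <= p1 by exact: le_trans p01.
  have h01 := mulr_ge0 p0_ge0 p1_ge0.
  have h0 := sqr_ge0 p0; have h1 := sqr_ge0 p1.
  case: (i \in S); case: (j \in S); case: (k \in S);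
    rewrite /= ?(mulr0, mulr1, addr0, add0r); nra.
rewrite sum_affine_in_S -/si -/sj le_eqVlt; apply/orP; left; apply/eqP; ring.
Qed.

(** The bound on common neighbours is squared with [(x + y + z)^2 <= 3 (x^2 + y^2 + z^2)],
    separately for zero, one or two of [i], [j] in [S], then summed over [i] and [j]. *)
Lemma triangle_dependence_le : triangle_dependence <=
  18 * (N%:R ^+ 4 * p0 ^+ 5 + N%:R ^+ 2 * n ^+ 2 * p0 ^+ 4 * p1
        + n ^+ 4 * p1 ^+ 5 + n ^+ 3 * N%:R * p0 ^+ 3 * p1 ^+ 2).
Proof.
apply: le_trans triangle_dependence_le_sum _.
have p1_ge0 : 0 <= p1 by exact: le_trans p01.
pose a := N%:R * p0 ^+ 2; pose b := n * p0 * p1; pose c := n * p1 ^+ 2.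
have a0 : 0 <= a by rewrite mulr_ge0 ?exprn_ge0.
have b0 : 0 <= b by rewrite !mulr_ge0.
have c0 : 0 <= c by rewrite mulr_ge0 ?exprn_ge0.
apply: (@le_trans _ _ (\sum_i \sum_j (3 * p0 * a ^+ 2
    + 6 * p0 * b ^+ 2 * ((i \in S)%:R + (j \in S)%:R)
    + (3 * p0 * c ^+ 2 + p1 * (3 * a ^+ 2 + 12 * b ^+ 2 + 3 * c ^+ 2))
       * ((i \in S)%:R * (j \in S)%:R)))).
  apply: ler_sum => i _; apply: ler_sum => j _.
  pose g : R := a + b * ((i \in S)%:R + (j \in S)%:R)
    + c * ((i \in S)%:R * (j \in S)%:R).
  apply: (@le_trans _ _ (q i j * g ^+ 2)).
    apply: ler_wpM2l; first exact: planted_edge_ge0.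
    apply: lerXn2r; rewrite ?nnegrE /g ?sum_common_neighbours //.
      by apply: sumr_ge0 => k _; rewrite mulr_ge0 ?planted_edge_ge0.
    by rewrite !addr_ge0 // !mulr_ge0 // ?addr_ge0.
  have sq (x y z : R) : (x + y + z) ^+ 2 <= 3 * (x ^+ 2 + y ^+ 2 + z ^+ 2).
    rewrite -subr_ge0 (_ : _ - _ =
      (x - y) ^+ 2 + (y - z) ^+ 2 + (x - z) ^+ 2); last ring.
    by rewrite !addr_ge0 ?sqr_ge0.
  have h1 := ler_wpM2l p1_ge0 (sq a (2 * b) c).
  have h2 := ler_wpM2l p0_ge0 (sq a b 0).
  have ha := mulr_ge0 p0_ge0 (sqr_ge0 a).
  have hb := mulr_ge0 p0_ge0 (sqr_ge0 b).
  have hc := mulr_ge0 p0_ge0 (sqr_ge0 c).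
  rewrite /g /q.
  case: (i \in S); case: (j \in S);
    rewrite /= ?(mulr0, mulr1, addr0, add0r); lra.
rewrite sum_sum_in_S /a /b /c.
have n0 : 0 <= n by [].
(* The terms in [n ^+ 4] carry [3 p0 p1^4], [12 p0^2 p1^3] and [3 p1^5]; as [p0 <= p1] they add up
   to at most [18 p1^5], which is where the constant comes from. *)
have h1 : 0 <= n ^+ 4 * p1 ^+ 4 * (p1 - p0).
  by rewrite !mulr_ge0 ?exprn_ge0 ?subr_ge0.
have h2 : 0 <= n ^+ 4 * p1 ^+ 3 * (p1 ^+ 2 - p0 ^+ 2).
  by rewrite !mulr_ge0 ?exprn_ge0 ?subr_ge0 // lerXn2r.
have h3 : 0 <= N%:R ^+ 4 * p0 ^+ 5 by rewrite mulr_ge0 ?exprn_ge0.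
have h4 : 0 <= N%:R ^+ 2 * n ^+ 2 * p0 ^+ 4 * p1 by rewrite !mulr_ge0 ?exprn_ge0.
have h5 : 0 <= n ^+ 3 * N%:R * p0 ^+ 3 * p1 ^+ 2.
  by rewrite !mulr_ge0 ?exprn_ge0.
lra.
Qed.

Lemma triangle_prob_ge A : is_triple A -> p0 ^+ 3 <= edges_prob q (clique_edges A).
Proof.
move=> tA; rewrite -(card_clique_edges tA) -prodr_const.
by apply: ler_prod => e _; rewrite p0_ge0 /q; case: ifP => _ /=.
Qed.

Lemma triangle_prob_sub A : is_triple A -> A \subset S ->
  edges_prob q (clique_edges A) = p1 ^+ 3.
Proof.
move=> tA /fintype.subsetP AS; rewrite -(card_clique_edges tA) -prodr_const.
by apply: eq_bigr => e; rewrite inE /q => /and3P[_ /AS-> /AS->].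
Qed.

Lemma triangle_prob_sparse A : is_triple A -> (#|A :&: S| <= 1)%N ->
  edges_prob q (clique_edges A) = p0 ^+ 3.
Proof.
move=> tA /card_le1_eqP AS; rewrite -(card_clique_edges tA) -prodr_const.
apply: eq_bigr => e; rewrite inE /q => /and3P[le e1 e2]; case: ifP => // /andP[s1 s2].
have e12 : e.1 = e.2 by apply: AS; rewrite inE ?e1 ?e2.
by move: le; rewrite /edge_slot e12 ltnn.
Qed.

(** The tuple supplies the preimage by which such triples are counted in [S * S * 'I_N]. *)
Lemma triangle_prob_pair A : is_triple A -> #|A :&: S| = 2%N ->
  edges_prob q (clique_edges A) <= p1 * p0 ^+ 2 /\
  exists t : 'I_N * 'I_N * 'I_N,
    [/\ t.1.1 \in S, t.1.2 \in S & [set t.1.1; t.1.2; t.2] = A].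
Proof.
move=> tA cAS; have /cards2P[i [j [ij AS]]] : #|A :&: S| == 2%N by apply/eqP.
have /cards1P[k Ak] : #|A :\: S| == 1%N.
  by move: tA; rewrite /is_triple -(cardsID S) cAS.
have defA : A = [set i; j; k] by rewrite -(finset.setID A S) AS Ak.
have /setIP[iA iS] : i \in A :&: S by rewrite AS !inE eqxx.
have /setIP[jA jS] : j \in A :&: S by rewrite AS !inE eqxx orbT.
have /setDP[kA kS] : k \in A :\: S by rewrite Ak inE.
have ik : i != k by apply: contraNneq kS => <-.
have jk : j != k by apply: contraNneq kS => <-.
split; last by exists ((i, j), k).
have -> : p1 * p0 ^+ 2 =
    \prod_(e <- [:: slot i j; slot i k; slot j k]) q e.1 e.2.
  rewrite !big_cons big_nil !planted_edge_slot /q iS jS (negbTE kS) /=; ring.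
apply: planted_prob_le; first exact: clique_edges_slots.
  rewrite /= !inE !slot_eq !eqxx (eq_sym j i).
  by rewrite (negbTE ij) (negbTE ik) (negbTE jk) ?(andbF, andFb, orbF).
by apply/allP; rewrite /= !slot_in_clique.
Qed.

Local Notation binN k m := ('C(k, m)%:R : R).

Lemma sum_triples_cst (c : R) :
  \sum_(A : {set 'I_N} | is_triple A) c = binN N 3 * c.
Proof.
rewrite sumr_const mulr_natl; congr (_ *+ _).
by rewrite -[N in RHS]card_ord -card_draws; apply: eq_card => A; rewrite !inE.
Qed.

Lemma sum_triples_sub (c : R) :
  \sum_(A : {set 'I_N} | is_triple A) (A \subset S)%:R * c = binN #|S| 3 * c.
Proof.
rewrite -mulr_suml; congr (_ * _); rewrite -cards_draws -sum1_card natr_sum.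
rewrite big_mkcond [RHS]big_mkcond; apply: eq_bigr => A _.
by rewrite inE /is_triple andbC; case: (_ == 3%N); case: (_ \subset _).
Qed.

(** Triples inside [S] are evaluated exactly, all others are bounded below by their null
    probability. *)
Lemma triangle_mean_ge :
  binN N 3 * p0 ^+ 3 + binN #|S| 3 * (p1 ^+ 3 - p0 ^+ 3) <= triangle_mean.
Proof.
rewrite -sum_triples_cst -sum_triples_sub -big_split /=.
apply: ler_sum => A tA; case: (boolP (A \subset S)) => AS /=.
  by rewrite mul1r addrC subrK triangle_prob_sub.
by rewrite mul0r addr0 triangle_prob_ge.
Qed.

(** Triples with at most one node in [S] have their null probability and those inside [S] have
    [p1 ^+ 3]. The last term pays for the triples with two nodes in [S], at most [n ^+ 2 * N] in
    number. *)
Lemma triangle_mean_le : triangle_mean <=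
  binN N 3 * p0 ^+ 3 + binN #|S| 3 * (p1 ^+ 3 - p0 ^+ 3)
  + n ^+ 2 * N%:R * (p1 * p0 ^+ 2).
Proof.
have p1_ge0 : 0 <= p1 by exact: le_trans p01.
apply: (@le_trans _ _ (\sum_(A : {set 'I_N} | is_triple A) (p0 ^+ 3 +
    (A \subset S)%:R * (p1 ^+ 3 - p0 ^+ 3) +
    (if #|A :&: S| == 2%N then p1 * p0 ^+ 2 else 0)))).
  apply: ler_sum => A tA; have [AS|AS] := boolP (A \subset S).
    rewrite triangle_prob_sub // mul1r [p0 ^+ 3 + _]addrC subrK lerDl.
    by case: ifP => _ //; rewrite mulr_ge0 ?exprn_ge0.
  rewrite mul0r addr0; case: ifP => [/eqP cAS|/eqP cAS].
    have [le _] := triangle_prob_pair tA cAS.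
    by rewrite (le_trans le) // lerDr exprn_ge0.
  rewrite addr0 triangle_prob_sparse //.
  have : (#|A :&: S| < 3)%N.
    rewrite -(eqP tA) proper_card // finset.properEneq finset.subsetIl andbT.
    by apply: contra AS => /eqP/finset.setIidPl.
  by rewrite ltnS leq_eqVlt => /orP[/eqP //|].
rewrite !big_split /= sum_triples_cst sum_triples_sub lerD2l -big_mkcondr /=.
apply: le_trans (ler_sum_surj (h := fun t : 'I_N * 'I_N * 'I_N =>
    [set t.1.1; t.1.2; t.2]) (Q := fun t => (t.1.1 \in S) && (t.1.2 \in S))
    (H := fun=> p1 * p0 ^+ 2) _ _) _.
- by move=> t _; rewrite mulr_ge0 ?exprn_ge0.
- move=> A /andP[tA /eqP cAS]; have [_ [t [t1 t2 tE]]] := triangle_prob_pair tA cAS.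
  by exists t; rewrite t1 t2.
rewrite sumr_const -[leLHS]mulr_natl ler_wpM2r ?mulr_ge0 ?exprn_ge0 //.
rewrite -natrX -natrM ler_nat.
rewrite (eq_card (B := finset.setX (finset.setX S S) finset.setT)).
  by rewrite !cardsX cardsT card_ord.
by move=> [[i j] k]; rewrite !inE andbT.
Qed.

End PlantedMoments.

Local Open Scope classical_set_scope.
Local Open Scope ring_scope.

(** * Poisson approximation *)

Section PoissonApproximation.
Variable R : realType.
Implicit Types (a : nat -> R) (x L mu eps eta : R) (k M : nat).

(* Unlike [poisson_pmf], which is constantly 1 there, also correct at [mu = 0]. *)
Definition poisson_weight mu k : R := mu ^+ k / k`!%:R * expR (- mu).

(** The terms of the exponential series are nonnegative and nondecreasing in [x], hence so are its
    tails. This makes the truncation error uniform over means up to [L]. *)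
Lemma exp_coeff_series_tail x L M : 0 <= x <= L ->
  0 <= expR x - series (exp_coeff x) M <= expR L - series (exp_coeff L) M.
Proof.
move=> /andP[x0 xL]; have L0 : 0 <= L by exact: le_trans xL.
have cvgE (y : R) : series (exp_coeff y) @ \oo --> expR y.
  exact: is_cvg_series_exp_coeff.
apply/andP; split.
  rewrite subr_ge0 -(cvg_lim _ (cvgE x)) //.
  apply: nondecreasing_cvgn_le; last exact: is_cvg_series_exp_coeff.
  apply/nondecreasing_seqP => k; rewrite seriesSr lerDl exp_coeff_ge0 //.
have cvgB : (fun k => series (exp_coeff L) k - series (exp_coeff x) k) @ \oo
    --> expR L - expR x by apply: cvgB; exact: cvgE.
suff : series (exp_coeff L) M - series (exp_coeff x) M <= expR L - expR x by lra.
rewrite -(cvg_lim _ cvgB) //.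
apply: (nondecreasing_cvgn_le
    (u_ := fun k => series (exp_coeff L) k - series (exp_coeff x) k));
  last by apply/cvg_ex; eexists; exact: cvgB.
apply/nondecreasing_seqP => k; rewrite !seriesSr opprD addrACA lerDl subr_ge0.
by rewrite /exp_coeff /= ler_wpM2r ?invr_ge0 ?lerXn2r ?nnegrE.
Qed.

(** * Sequences that nearly satisfy the Poisson recurrence *)

Section Recurrence.
Variables (a : nat -> R) (mu L eps : R).
Hypotheses (mu0 : 0 <= mu) (muL : mu <= L) (a0 : forall k, 0 <= a k).
Hypothesis a_rec : forall k, `|k.+1%:R * a k.+1 - mu * a k| <= eps.
Hypothesis a_sum : forall M,
  1 - mu / M.+1%:R <= \sum_(0 <= k < M.+1) a k <= 1.

Let L0 : 0 <= L. Proof. exact: le_trans muL. Qed.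
Let eps0 : 0 <= eps. Proof. exact: le_trans (a_rec 0). Qed.

(** By induction: a step multiplies the error by [mu <= L] and adds [eps], while dividing by [k.+1]
    only helps; finally [eps + L * eps * (L + 1)^k <= eps * (L + 1)^(k + 1)]. *)
Lemma recurrence_near k :
  `|a k - exp_coeff mu k * a 0| <= eps * (L + 1) ^+ k.
Proof.
elim: k => [|k IH].
  by rewrite /exp_coeff /= expr0 fact0 divr1 mul1r subrr normr0 mulr1.
have k1 : (1 : R) <= k.+1%:R by rewrite ler1n.
have kp : (0 : R) < k.+1%:R by [].
have -> : a k.+1 - exp_coeff mu k.+1 * a 0 = k.+1%:R^-1 *
    ((k.+1%:R * a k.+1 - mu * a k) + mu * (a k - exp_coeff mu k * a 0)).
  rewrite /exp_coeff /= factS natrM exprS; field.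
  by rewrite pnatr_eq0 -lt0n fact_gt0 /= addrC -natr1 in kp *; rewrite gt_eqF.
rewrite normrM normfV (ger0_norm (ltW kp)) mulrC ler_pdivrMr //.
apply: le_trans (ler_normD _ _) _; rewrite normrM (ger0_norm mu0).
apply: (@le_trans _ _ (eps * (L + 1) ^+ k.+1)).
  have h1 : mu * `|a k - exp_coeff mu k * a 0| <= L * (eps * (L + 1) ^+ k).
    by apply: ler_pM.
  have h2 : 1 <= (L + 1) ^+ k by rewrite exprn_ege1 // lerDr.
  have h3 := ler_wpM2l eps0 h2; have h4 := a_rec k.
  rewrite exprS; lra.
by rewrite -[leLHS]mulr1 ler_wpM2l ?mulr_ge0 ?exprn_ge0 ?addr_ge0.
Qed.

(** Up to the accumulated recurrence error, the first [M.+1] terms sum to [a 0] times the truncated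
    exponential [s], and this sum is close to 1. The three errors are the truncation, the recurrence
    and the missing mass. *)
Lemma recurrence_at0 M : `|a 0 - expR (- mu)| <=
  (expR L - series (exp_coeff L) M.+1)
  + (eps * \sum_(0 <= k < M.+1) (L + 1) ^+ k + L / M.+1%:R).
Proof.
set s := series (exp_coeff mu) M.+1.
have e1 : expR (- mu) <= 1 by rewrite -expR0 ler_expR oppr_le0.
have e0 : 0 <= expR (- mu) by exact: expR_ge0.
have a01 : a 0 <= 1 by have /andP[_] := a_sum 0; rewrite big_nat1.
have /andP[t0 tL] : 0 <= expR mu - s <= expR L - series (exp_coeff L) M.+1.
  by apply: exp_coeff_series_tail; rewrite mu0.
have -> : a 0 - expR (- mu) = a 0 * (expR (- mu) * (expR mu - s))
    + expR (- mu) * (s * a 0 - 1).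
  rewrite mulrBr -expRD addNr expR0; ring.
apply: le_trans (ler_normD _ _) _; apply: lerD.
  rewrite ger0_norm ?mulr_ge0 //; apply: le_trans tL.
  rewrite -[leRHS]mul1r; apply: ler_pM; rewrite ?mulr_ge0 //.
  by rewrite -[leRHS]mul1r ler_wpM2r.
rewrite normrM (ger0_norm e0) -[leRHS]mul1r; apply: ler_pM => //.
have -> : s * a 0 - 1 = (\sum_(0 <= k < M.+1) a k - 1)
    - \sum_(0 <= k < M.+1) (a k - exp_coeff mu k * a 0).
  by rewrite sumrB -mulr_suml /s /series /=; ring.
apply: le_trans (ler_normB _ _) _; rewrite addrC; apply: lerD.
  apply: le_trans (ler_norm_sum _ _ _) _; rewrite mulr_sumr.
  by apply: ler_sum => k _; exact: recurrence_near.
have /andP[l u] := a_sum M; rewrite ler0_norm ?subr_le0 // opprB.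
apply: (@le_trans _ _ (mu / M.+1%:R)); first by rewrite lerBlDr -lerBlDl.
by rewrite ler_wpM2r ?invr_ge0.
Qed.

End Recurrence.

(** The tolerance [eps] depends only on [L], [eta] and [k], so the estimate is uniform in the
    sequence and in its mean. *)
Lemma poisson_recurrence L eta k : 0 <= L -> 0 < eta ->
  exists2 eps, 0 < eps & forall a mu, 0 <= mu <= L -> (forall k, 0 <= a k) ->
    (forall k, `|k.+1%:R * a k.+1 - mu * a k| <= eps) ->
    (forall M, 1 - mu / M.+1%:R <= \sum_(0 <= k < M.+1) a k <= 1) ->
    `|a k - poisson_weight mu k| <= eta.
Proof.
move=> L0 eta0; pose c := L ^+ k + 1.
have c0 : 0 < c by rewrite ltr_wpDl ?exprn_ge0.
(* Three errors of size [d] on [a 0], multiplied by a coefficient at most [c], and one on [a k]; as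
   [c >= 1], their total is at most [4 * c * d = eta]. *)
pose d := eta / (4 * c).
have d0 : 0 < d by rewrite divr_gt0 // mulr_gt0.
have [M [tM LM]] : exists M, expR L - series (exp_coeff L) M.+1 <= d /\
    L / M.+1%:R <= d.
  near \oo => M; exists M; split; last first.
    rewrite ler_pdivrMr // mulrC -ler_pdivrMr //.
    apply: (@le_trans _ _ M%:R); last by rewrite ler_nat.
    by near: M; exact: nbhs_infty_ger.
  apply: (le_trans (ler_norm _)); near: M.
  have : (fun M => series (exp_coeff L) M.+1) @ \oo --> expR L.
    by rewrite (cvg_shiftS (series (exp_coeff L))); exact: is_cvg_series_exp_coeff.
  by move=> /cvgrPdist_le /(_ _ d0).
(* [M] being fixed, the single tolerance [d / K] controls both the sum of the recurrence errors and
   the error at [k]. *)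
pose K := \sum_(0 <= j < M.+1) (L + 1) ^+ j + (L + 1) ^+ k.
have K0 : 0 < K.
  rewrite ltr_wpDl ?exprn_gt0 ?ltr_wpDl // sumr_ge0 // => j _.
  by rewrite exprn_ge0 // addr_ge0.
exists (d / K) => [|a mu /andP[mu0 muL] a0 a_rec a_sum]; first exact: divr_gt0.
have h0 := recurrence_at0 mu0 muL a0 a_rec a_sum M.
have hk := recurrence_near mu0 muL a_rec k.
have dK : 0 <= d / K by rewrite divr_ge0 // ltW.
have sK : d / K * \sum_(0 <= j < M.+1) (L + 1) ^+ j <= d.
  rewrite mulrAC ler_pdivrMr // ler_wpM2l ?(ltW d0) // lerDl.
  by rewrite exprn_ge0 // addr_ge0.
have pK : d / K * (L + 1) ^+ k <= d.
  rewrite mulrAC ler_pdivrMr // ler_wpM2l ?(ltW d0) // lerDr.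
  by rewrite sumr_ge0 // => j _; rewrite exprn_ge0 // addr_ge0.
have b0 : 0 <= exp_coeff mu k by rewrite exp_coeff_ge0.
have bc : exp_coeff mu k <= c.
  rewrite /exp_coeff /= ler_pdivrMr ?ltr0n ?fact_gt0 //.
  apply: (@le_trans _ _ (L ^+ k)); first by rewrite lerXn2r ?nnegrE.
  rewrite -[leLHS]mulr1; apply: ler_pM; rewrite ?exprn_ge0 ?lerDl //.
  by rewrite ler1n fact_gt0.
have -> : a k - poisson_weight mu k = (a k - exp_coeff mu k * a 0)
    + exp_coeff mu k * (a 0 - expR (- mu)).
  by rewrite /poisson_weight /exp_coeff /=; ring.
apply: le_trans (ler_normD _ _) _; rewrite normrM (ger0_norm b0).
have h3 : exp_coeff mu k * `|a 0 - expR (- mu)| <= c * (3 * d).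
  apply: ler_pM => //; apply: (le_trans h0).
  by rewrite (_ : 3 * d = d + (d + d)) ?lerD //; ring.
have c1 : 1 <= c by rewrite lerDr exprn_ge0.
have dc : d <= c * d by rewrite ler_peMl // ltW.
have -> : eta = c * (4 * d) by rewrite /d; field; rewrite gt_eqF.
lra.
Unshelve. all: by end_near.
Qed.

End PoissonApproximation.

(** * Tails and point probabilities of the triangle count *)

Section PlantedProbability.
Variables (R : realType) (N : nat) (p0 p1 : R) (S : {set 'I_N}).
Hypotheses (p0_ge0 : 0 <= p0) (p01 : p0 <= p1) (p1_le1 : p1 <= 1).

Local Notation Pr := (prob_planted p0 p1 S).
Local Notation mu := (triangle_mean p0 p1 S).
Local Notation D := (triangle_dependence p0 p1 S).
Local Notation T := (subgraph_count (@is_triple N) (@clique_edges N)).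
Local Notation q := (planted_edge p0 p1 S).

Let q01 (e : 'I_N * 'I_N) : edge_slot e -> 0 <= q e.1 e.2 <= 1.
Proof. exact: planted_edge01. Qed.

Let slots (A : {set 'I_N}) : is_triple A -> edge_slots (clique_edges A).
Proof. by move=> _; exact: clique_edges_slots. Qed.

Lemma prob_plantedE (E : 'M[bool]_N -> bool) :
  Pr E = graph_exp q (fun W => (E W)%:R).
Proof. exact: graph_probE. Qed.

Lemma prob_planted_ge0 E : 0 <= Pr E.
Proof. by rewrite prob_plantedE; apply: graph_exp_ge0. Qed.

Lemma prob_planted_eq (E E' : 'M[bool]_N -> bool) :
  (forall W, simple_graph W -> E W = E' W) -> Pr E = Pr E'.
Proof. by move=> EE'; rewrite !prob_plantedE; apply: graph_exp_ext => W /EE'->. Qed.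

Lemma prob_plantedC E : Pr (fun W => ~~ E W) = 1 - Pr E.
Proof.
rewrite !prob_plantedE -[X in X - _](graph_exp1 q) -graph_expB.
by apply: graph_exp_ext => W _; case: (E W); rewrite ?subrr ?subr0.
Qed.

Lemma triangle_mean_ge0 : 0 <= mu.
Proof. exact: mean_count_ge0. Qed.

(** Chebyshev's inequality, for an arbitrary event forcing a deviation [d] so that it serves both
    types of error. *)
Lemma prob_planted_tail (d : R) (E : 'M[bool]_N -> bool) : 0 < d ->
  (forall W, E W -> d <= `|triangles R W - mu|) ->
  Pr E <= (mu + D) / d ^+ 2.
Proof.
move=> d0 Ed; rewrite ler_pdivlMr ?exprn_gt0 // mulrC.
apply: le_trans (var_count_le q01 slots); rewrite prob_plantedE -graph_expZ.
apply: ler_graph_exp => // W sW; case: (boolP (E W)) => [/Ed|_] /=.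
  rewrite mulr1 trianglesE // => dT; rewrite -[leRHS]real_normK ?num_real //.
  by rewrite lerXn2r ?nnegrE ?(ltW d0).
by rewrite mulr0 sqr_ge0.
Qed.

(** A triangle is at most as likely as any one of its edges, so the sum of squared probabilities is
    at most [p1 * mu]. *)
Lemma planted_stein_chen k :
  `|k.+1%:R * Pr (fun W => triangles R W == k.+1%:R)
    - mu * Pr (fun W => triangles R W == k%:R)| <= 2 * D + p1 * mu.
Proof.
have PrE j : Pr (fun W => triangles R W == j%:R) =
    graph_exp q (fun W => (T W == j)%:R).
  rewrite prob_plantedE; apply: graph_exp_ext => W sW.
  by rewrite trianglesE // eqr_nat.
rewrite !PrE; apply: le_trans (stein_chen_count q01 slots _ k) _.
  exact: clique_edges_neq0.
rewrite lerD2l mulr_sumr; apply: ler_sum => A tA; rewrite expr2.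
have sA : edge_slots (clique_edges A) by apply: slots.
rewrite ler_wpM2r ?edges_prob_ge0 //.
have /set0Pn[e eA] := clique_edges_neq0 tA.
apply: (@le_trans _ _ (edges_prob q [set e])).
  by apply: edges_prob_le => //; rewrite finset.sub1set.
by rewrite /edges_prob big_set1 /q; case: ifP.
Qed.

Lemma sum_prob_planted M :
  \sum_(0 <= k < M) Pr (fun W => triangles R W == k%:R) =
  Pr (fun W => triangles R W < M%:R).
Proof.
elim: M => [|M IH].
  rewrite big_nil prob_plantedE -[LHS](graph_exp_cst q).
  by apply: graph_exp_ext => W _; rewrite ltNge ler0n.
rewrite big_nat_recr //= IH !prob_plantedE -graph_expD.
apply: graph_exp_ext => W sW; rewrite trianglesE // eqr_nat !ltr_nat ltnS.
rewrite [in RHS]leq_eqVlt.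
by case: ltngtP => _ /=; rewrite ?mulr0n ?addr0 ?add0r.
Qed.

(** The sum is the probability of fewer than [M.+1] triangles; its complement is bounded by Markov's
    inequality. *)
Lemma sum_prob_planted_bounds M : 1 - mu / M.+1%:R <=
  \sum_(0 <= k < M.+1) Pr (fun W => triangles R W == k%:R) <= 1.
Proof.
rewrite sum_prob_planted; have := prob_plantedC (fun W => triangles R W < M.+1%:R).
set E := Pr (fun W => ~~ _) => EE.
have -> : Pr (fun W => triangles R W < M.+1%:R) = 1 - E by rewrite EE; ring.
rewrite lerD2l lerN2 gerBl prob_planted_ge0 andbT ler_pdivlMr // mulrC.
rewrite /triangle_mean -(exp_count q slots) /E prob_plantedE -graph_expZ.
apply: ler_graph_exp => // W sW; rewrite -leNgt trianglesE // ler_nat.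
by case: leqP => h; rewrite ?mulr0 ?mulr1 ?ler_nat.
Qed.

Lemma prob_planted_le_sum x M : M%:R <= x < M.+1%:R ->
  Pr (fun W => triangles R W <= x) =
  \sum_(0 <= k < M.+1) Pr (fun W => triangles R W == k%:R).
Proof.
move=> /andP[Mx xM]; rewrite sum_prob_planted; apply: prob_planted_eq => W sW.
rewrite trianglesE // ltr_nat ltnS; apply/idP/idP => h.
  by rewrite -ltnS -(ltr_nat R) (le_lt_trans h).
by rewrite (le_trans _ Mx) // ler_nat.
Qed.

End PlantedProbability.

(** Planted estimates with empty [S] thereby become estimates under the null law, whatever the value
    of [p1]. *)
Lemma prob_null_planted (R : realType) (N : nat) (p0 p1 : R)
    (E : 'M[bool]_N -> bool) :
  prob_null p0 E = prob_planted p0 p1 finset.set0 E.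
Proof.
rewrite /prob_null /prob_planted; congr graph_prob.
by apply/funext => i; apply/funext => j; rewrite finset.in_set0.
Qed.

(** * Non-asymptotic bounds *)

Section ExplicitBounds.
Variable R : realType.
Implicit Types (N n : nat) (L eta : R).

Lemma natr_bin3 n : 6 * 'C(n, 3)%:R = n%:R * (n%:R - 1) * (n%:R - 2) :> R.
Proof.
elim: n => [|n IH]; first by rewrite bin0n mulr0 !mul0r.
have bin2E : 2 * 'C(n, 2)%:R = n%:R * (n%:R - 1) :> R.
  elim: n {IH} => [|n IH]; first by rewrite bin0n mulr0 mul0r.
  by rewrite binS bin1 natrD mulrDr IH -natr1; ring.
by rewrite binS natrD -natr1; lra.
Qed.

Lemma bin3_le n : 'C(n, 3)%:R <= n%:R ^+ 3 :> R.
Proof.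
have := natr_bin3 n; case: n => [|[|n]]; rewrite ?bin0n ?exprn_ge0 //.
rewrite -2!natr1; set m := (n%:R : R); have m0 : 0 <= m by [].
have : 0 <= (m + 1 + 1) ^+ 2 by exact: sqr_ge0.
by have := sqr_ge0 m; nra.
Qed.

(** The difference of the two sides is [m^2 (m - 6) + 4 m], where [m] is [n] as a real number. *)
Lemma bin3_ge n : (6 <= n)%N -> n%:R ^+ 3 <= 12 * 'C(n, 3)%:R :> R.
Proof.
move=> n6; have n6R : 6 <= n%:R :> R by rewrite ler_nat.
have := natr_bin3 n; set m := (n%:R : R) in n6R *.
have : 0 <= m * (m * (m - 6)) by rewrite !mulr_ge0 ?subr_ge0 //; lra.
by lra.
Qed.

Section Planted.
Variables (N : nat) (p0 p1 : R) (S : {set 'I_N}).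
Hypotheses (p0_ge0 : 0 <= p0) (p01 : p0 <= p1) (p1_le1 : p1 <= 1).
Local Notation x := (N%:R * p0).
Local Notation y := (#|S|%:R * p1).
Local Notation w := (#|S|%:R * p0).

Let p1_ge0 : 0 <= p1. Proof. exact: le_trans p01. Qed.
Let x0 : 0 <= x. Proof. by rewrite mulr_ge0. Qed.
Let y0 : 0 <= y. Proof. by rewrite mulr_ge0. Qed.
Let w0 : 0 <= w. Proof. by rewrite mulr_ge0. Qed.

Lemma triangle_mean_bound :
  triangle_mean p0 p1 S <= x ^+ 3 + y ^+ 3 + x * y * w.
Proof.
apply: le_trans (triangle_mean_le _ p0_ge0 p01 p1_le1) _; apply: lerD.
  apply: lerD; rewrite exprMn.
    by rewrite ler_wpM2r ?exprn_ge0 ?bin3_le.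
  apply: ler_pM; rewrite ?subr_ge0 ?lerXn2r ?nnegrE ?bin3_le //.
  by rewrite gerBl exprn_ge0.
rewrite le_eqVlt; apply/orP; left; apply/eqP; ring.
Qed.

Lemma triangle_dependence_bound : triangle_dependence p0 p1 S <=
  18 * (x ^+ 4 * p0 + x ^+ 2 * y * w * p0 + y ^+ 4 * p1 + x * y ^+ 2 * w * p0).
Proof.
apply: le_trans (triangle_dependence_le _ p0_ge0 p01 p1_le1) _.
rewrite le_eqVlt; apply/orP; left; apply/eqP; ring.
Qed.

(** The binomial coefficient is at least [n^3 / 12], and [2 * p0 <= p1] leaves at least half of
    [p1^3] in [p1^3 - p0^3]; hence the factor 24. *)
Lemma triangle_mean_gap : (6 <= #|S|)%N -> 2 * p0 <= p1 ->
  'C(N, 3)%:R * p0 ^+ 3 + y ^+ 3 / 24 <= triangle_mean p0 p1 S.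
Proof.
move=> n6 p2; apply: le_trans (triangle_mean_ge _ p0_ge0 p01).
rewrite lerD2l ler_pdivrMr // exprMn.
have h1 : p1 ^+ 3 <= 2 * (p1 ^+ 3 - p0 ^+ 3).
  have : (2 * p0) ^+ 3 <= p1 ^+ 3 by rewrite lerXn2r ?nnegrE ?mulr_ge0.
  by have := exprn_ge0 3 p0_ge0; nra.
have := ler_pM _ _ (bin3_ge n6) h1; rewrite !exprn_ge0 // => /(_ isT isT).
by lra.
Qed.

(** Each of the four dependence terms is at most [L^4 * p1], and the mean is at most [3 * L^3]; thus
    [147 = 2 * 18 * 4 + 3]. *)
Lemma planted_stein_bound L : 1 <= L -> x <= L -> y <= L -> w <= 1 ->
  triangle_mean p0 p1 S <= 3 * L ^+ 3 /\
  2 * triangle_dependence p0 p1 S + p1 * triangle_mean p0 p1 S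
    <= 147 * L ^+ 4 * p1.
Proof.
move=> L1 xL yL w1; have L0 : 0 <= L by lra.
have p0_le1 : p0 <= 1 by exact: le_trans p1_le1.
have le_expL (i k : nat) : (i <= k)%N -> L ^+ i <= L ^+ k.
  by move=> ik; rewrite ler_weXn2l.
have xp k : x ^+ k <= L ^+ k by rewrite lerXn2r ?nnegrE.
have yp k : y ^+ k <= L ^+ k by rewrite lerXn2r ?nnegrE.
have xy i j k : (i + j <= k)%N -> x ^+ i * y ^+ j <= L ^+ k.
  move=> /le_expL; apply: le_trans; rewrite exprD.
  by apply: ler_pM; rewrite ?exprn_ge0.
have wp : w * p0 <= p1 by rewrite -[leRHS]mul1r ler_pM.
have mean3 : triangle_mean p0 p1 S <= 3 * L ^+ 3.
  apply: le_trans triangle_mean_bound _.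
  have := xp 3%N; have := yp 3%N.
  have : x * y * w <= L ^+ 3.
    rewrite -[leRHS]mulr1; apply: ler_pM; rewrite ?mulr_ge0 //.
    exact: (xy 1%N 1%N).
  lra.
split=> //.
have h1 : triangle_dependence p0 p1 S <= 18 * (4 * (L ^+ 4 * p1)).
  apply: le_trans triangle_dependence_bound _; rewrite ler_wpM2l //.
  have a1 : x ^+ 4 * p0 <= L ^+ 4 * p1 by apply: ler_pM; rewrite ?exprn_ge0.
  have a2 : x ^+ 2 * y * w * p0 <= L ^+ 4 * p1.
    rewrite -mulrA; apply: ler_pM; rewrite ?mulr_ge0 ?exprn_ge0 //.
    exact: (xy 2%N 1%N).
  have a3 : y ^+ 4 * p1 <= L ^+ 4 * p1 by rewrite ler_wpM2r.
  have a4 : x * y ^+ 2 * w * p0 <= L ^+ 4 * p1.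
    rewrite -mulrA; apply: ler_pM; rewrite ?mulr_ge0 ?exprn_ge0 //.
    exact: (xy 1%N 2%N).
  lra.
have h2 : p1 * triangle_mean p0 p1 S <= 3 * (L ^+ 4 * p1).
  rewrite mulrC mulrA ler_wpM2r // (le_trans mean3) // ler_wpM2l //.
  exact: le_expL.
lra.
Qed.

End Planted.

(** The lower and upper bounds on the mean coincide when [S] is empty. *)
Lemma triangle_mean_null N (p0 p1 : R) : 0 <= p0 -> p0 <= p1 -> p1 <= 1 ->
  triangle_mean p0 p1 (finset.set0 : {set 'I_N}) = 'C(N, 3)%:R * p0 ^+ 3.
Proof.
move=> p0_ge0 p01 p1_le1; apply/le_anti/andP; split.
  have := triangle_mean_le (finset.set0 : {set 'I_N}) p0_ge0 p01 p1_le1.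
  by rewrite cards0 bin0n !mul0r !addr0 expr0n /= !mul0r addr0.
have := triangle_mean_ge (finset.set0 : {set 'I_N}) p0_ge0 p01.
by rewrite cards0 bin0n !mul0r !addr0.
Qed.

Lemma risk_ge0 N n (p0 p1 : R) (phi : 'M[bool]_N -> bool) :
  0 <= p0 -> p0 <= p1 -> p1 <= 1 -> 0 <= risk n p0 p1 phi.
Proof.
move=> p0_ge0 p01 p1_le1; rewrite /risk addr_ge0 //.
  by rewrite (prob_null_planted p0 p1) prob_planted_ge0.
by rewrite bigmax_ge_id.
Qed.

(** The condition [0 <= b] covers the default value of the maximum. *)
Lemma risk_le N n (p0 p1 : R) (phi : 'M[bool]_N -> bool) (a b : R) :
  0 <= b -> prob_null p0 phi <= a ->
  (forall S : {set 'I_N}, #|S| = n ->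
     prob_planted p0 p1 S (fun W => ~~ phi W) <= b) ->
  risk n p0 p1 phi <= a + b.
Proof.
move=> b0 nullE plantE; rewrite /risk lerD // bigmax_le // => S /eqP.
exact: plantE.
Qed.

(* The null mean plus half of the gap of [triangle_mean_gap]. *)
Definition triangle_threshold N n (p0 p1 : R) : R :=
  'C(N, 3)%:R * p0 ^+ 3 + (n%:R * p1) ^+ 3 / 48.

(** Either error forces a deviation of at least [y^3 / 48], half of the gap, from the corresponding
    mean; Chebyshev's inequality then produces [2304 = 48^2]. *)
Lemma triangle_risk_le N n (p0 p1 : R) : (6 <= n)%N -> 0 <= p0 -> 0 < p1 ->
  2 * p0 <= p1 -> p1 <= 1 -> n%:R * p0 <= 1 ->
  forall x y, x = N%:R * p0 -> y = n%:R * p1 ->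
  risk n p0 p1 (threshold_test (@triangles R N) (triangle_threshold N n p0 p1))
  <= 2304 * (2 * x ^+ 3 + y ^+ 3 + x * y + 36 * (x ^+ 4 * p0)
     + 18 * (x ^+ 2 * y + y ^+ 4 + x * y ^+ 2)) / y ^+ 6.
Proof.
move=> n6 p0_ge0 p1_gt0 p2 p1_le1 w1 x y xE yE.
have p01 : p0 <= p1 by lra.
have n_gt0 : 0 < n%:R :> R by rewrite ltr0n (leq_trans _ n6).
have x0 : 0 <= x by rewrite xE mulr_ge0.
have y_gt0 : 0 < y by rewrite yE mulr_gt0.
have y0 := ltW y_gt0.
have d0 : 0 < y ^+ 3 / 48 by rewrite divr_gt0 ?exprn_gt0.
set V := 2 * x ^+ 3 + _ + _ + _ + _.
(* [V1] and [V0] bound mean plus dependence under the planted and the null law; in [V1] factors such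
   as [n * p0] and [p1] are replaced by 1. *)
pose V1 := x ^+ 3 + y ^+ 3 + x * y + 18 * (x ^+ 4 * p0)
  + 18 * (x ^+ 2 * y + y ^+ 4 + x * y ^+ 2).
pose V0 := x ^+ 3 + 18 * (x ^+ 4 * p0).
have -> : 2304 * V / y ^+ 6 = V0 / (y ^+ 3 / 48) ^+ 2 + V1 / (y ^+ 3 / 48) ^+ 2.
  by rewrite /V /V0 /V1; field; rewrite gt_eqF.
apply: risk_le.
- rewrite divr_ge0 ?sqr_ge0 // /V1.
  by rewrite !addr_ge0 ?mulr_ge0 ?addr_ge0 ?mulr_ge0 ?exprn_ge0.
- rewrite (prob_null_planted p0 p1).
  apply: le_trans (_ : _ <= (triangle_mean p0 p1 (finset.set0 : {set 'I_N})
    + triangle_dependence p0 p1 (finset.set0 : {set 'I_N}))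
      / (y ^+ 3 / 48) ^+ 2) _.
    apply: prob_planted_tail => // W; rewrite /threshold_test triangle_mean_null //.
    rewrite /triangle_threshold -yE => h; apply: le_trans (ler_norm _).
    by rewrite lerBrDl.
  rewrite ler_wpM2r ?invr_ge0 ?sqr_ge0 //; apply: lerD.
    have := triangle_mean_bound (finset.set0 : {set 'I_N}) p0_ge0 p01 p1_le1.
    by rewrite cards0 !mul0r expr0n !mulr0 !addr0 -xE.
  have := triangle_dependence_bound (finset.set0 : {set 'I_N}) p0_ge0 p01 p1_le1.
  by rewrite cards0 !mul0r !expr0n !mulr0 !mul0r !addr0 -xE.
move=> S Sn; apply: le_trans (_ : _ <= (triangle_mean p0 p1 S
    + triangle_dependence p0 p1 S) / (y ^+ 3 / 48) ^+ 2) _.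
  have := triangle_mean_gap p0_ge0 p01 (S := S).
  rewrite Sn -yE => /(_ n6 p2) gap.
  apply: prob_planted_tail => // W; rewrite /threshold_test -ltNge.
  rewrite /triangle_threshold -yE => h; rewrite distrC.
  by apply: le_trans (ler_norm _); lra.
rewrite ler_wpM2r ?invr_ge0 ?sqr_ge0 //.
have := triangle_mean_bound S p0_ge0 p01 p1_le1.
have := triangle_dependence_bound S p0_ge0 p01 p1_le1.
rewrite Sn -xE -yE; set w := n%:R * p0.
have w0 : 0 <= w by rewrite mulr_ge0.
have le1 (a b : R) : 0 <= a -> 0 <= b <= 1 -> a * b <= a.
  by move=> a0 /andP[b0 b1]; rewrite ler_piMr.
have wp : 0 <= w * p0 <= 1 by rewrite mulr_ge0 // mulr_ile1 //; lra.
have b1 : x * y * w <= x * y by rewrite le1 ?mulr_ge0 // w0.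
have b2 : x ^+ 2 * y * w * p0 <= x ^+ 2 * y.
  by rewrite -mulrA; apply: le1 => //; rewrite mulr_ge0 ?exprn_ge0.
have b3 : x * y ^+ 2 * w * p0 <= x * y ^+ 2.
  by rewrite -mulrA; apply: le1 => //; rewrite mulr_ge0 ?exprn_ge0.
have b4 : y ^+ 4 * p1 <= y ^+ 4 by rewrite le1 ?exprn_ge0 // (ltW p1_gt0).
rewrite /V1; lra.
Qed.

(** The recurrence error is at most [147 * L^4 * p1], so it suffices that [p1] be small. The choice
    of [delta] is uniform in [N], [S] and the edge probabilities. *)
Lemma planted_poisson L eta k : 1 <= L -> 0 < eta ->
  exists2 delta, 0 < delta & forall N (S : {set 'I_N}) (p0 p1 : R),
    0 <= p0 -> p0 <= p1 -> p1 <= 1 -> p1 <= delta ->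
    N%:R * p0 <= L -> #|S|%:R * p1 <= L -> #|S|%:R * p0 <= 1 ->
    `|prob_planted p0 p1 S (fun W => triangles R W == k%:R)
      - poisson_weight (triangle_mean p0 p1 S) k| <= eta.
Proof.
move=> L1 eta0; have L0 : 0 <= L by lra.
have L3 : 0 <= 3 * L ^+ 3 by rewrite mulr_ge0 ?exprn_ge0.
have [eps eps0 Heps] := poisson_recurrence k L3 eta0.
have c0 : 0 < 147 * L ^+ 4 by rewrite mulr_gt0 ?exprn_gt0 //; lra.
exists (eps / (147 * L ^+ 4)) => [|N S p0 p1 p0_ge0 p01 p1_le1 pd xL yL w1].
  exact: divr_gt0.
have [mL DL] := planted_stein_bound p0_ge0 p01 p1_le1 L1 xL yL w1.
apply: (Heps (fun k => prob_planted p0 p1 S (fun W => triangles R W == k%:R))).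
- by rewrite triangle_mean_ge0.
- by move=> j; rewrite prob_planted_ge0.
- move=> j; apply: le_trans (planted_stein_chen _ p0_ge0 p01 p1_le1 j) _.
  by apply: (le_trans DL); rewrite mulrC -ler_pdivlMr.
- by move=> M; exact: sum_prob_planted_bounds.
Qed.

End ExplicitBounds.

(** Every monomial of the numerator in [triangle_risk_le] is at most [y^6 / A]; the coefficients sum
    to [2 + 1 + 1 + 36 + 3 * 18 = 94]. *)
Lemma risk_small (R : realType) (N n : nat) (p0 p1 A : R) :
  (6 <= n)%N -> 0 <= p0 -> p0 < p1 -> p1 <= 1 -> n%:R * p0 <= 1 -> 2 <= A ->
  let x := N%:R * p0 in let y := n%:R * p1 in
  A <= y -> A * x <= y ^+ 2 -> A * (x ^+ 4 * p0) <= y ^+ 6 ->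
  risk n p0 p1 (threshold_test (@triangles R N) (triangle_threshold N n p0 p1))
  <= (2304 * 94) / A.
Proof.
move=> n6 p0_ge0 p01 p1_le1 w1 A2 x y Ay Ax Ax4.
have n_gt0 : 0 < n%:R :> R by rewrite ltr0n (leq_trans _ n6).
have x0 : 0 <= x by rewrite mulr_ge0.
have y1 : 1 <= y by lra.
(* After multiplication by [n]: [2 * n * p0 <= 2 <= A <= y]. *)
have p2 : 2 * p0 <= p1 by rewrite -(ler_pM2l n_gt0) -/y; lra.
have p1_gt0 : 0 < p1 by exact: le_lt_trans p01.
have h := @triangle_risk_le _ N n p0 p1 n6 p0_ge0 p1_gt0 p2 p1_le1 w1 x y erefl erefl.
apply: (le_trans h).
have A0 : 0 < A by lra.
have y0 : 0 <= y by lra.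
have yX i : (i <= 6)%N -> y ^+ i <= y ^+ 6 by move=> i6; rewrite ler_weXn2l.
have A1 : 1 <= A by lra.
have xy2 : x <= y ^+ 2 by have := ler_peMl x0 A1; lra.
have x2 : 0 <= x ^+ 2 by exact: sqr_ge0.
have x2y4 : x ^+ 2 <= y ^+ 4.
  by rewrite (_ : y ^+ 4 = (y ^+ 2) ^+ 2) ?lerXn2r ?nnegrE ?exprn_ge0 //; ring.
have h1 : A * x ^+ 3 <= y ^+ 6.
  rewrite exprS mulrA (_ : y ^+ 6 = y ^+ 2 * y ^+ 4); last by ring.
  by apply: ler_pM; rewrite ?mulr_ge0 ?(ltW A0).
have h2 : A * y ^+ 3 <= y ^+ 6.
  apply: le_trans (yX 4%N isT); rewrite [leRHS]exprS.
  by apply: ler_pM; rewrite ?exprn_ge0 ?(ltW A0) ?lexx.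
have h3 : A * (x * y) <= y ^+ 6.
  apply: le_trans (yX 3%N isT); rewrite mulrA exprSr.
  by rewrite ler_wpM2r.
have h4 : A * (x ^+ 2 * y) <= y ^+ 6.
  apply: le_trans (yX 5%N isT).
  rewrite (_ : A * (x ^+ 2 * y) = (A * x) * (x * y)); last by ring.
  rewrite (_ : y ^+ 5 = y ^+ 2 * (y ^+ 2 * y)); last by ring.
  have xy : x * y <= y ^+ 2 * y by rewrite ler_wpM2r.
  by apply: (ler_pM _ _ Ax xy); rewrite mulr_ge0 ?(ltW A0).
have h5 : A * y ^+ 4 <= y ^+ 6.
  apply: le_trans (yX 5%N isT); rewrite [leRHS]exprS.
  by apply: ler_pM; rewrite ?exprn_ge0 ?(ltW A0) ?lexx.
have h6 : A * (x * y ^+ 2) <= y ^+ 6.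
  apply: le_trans (yX 4%N isT).
  rewrite mulrA (_ : y ^+ 4 = y ^+ 2 * y ^+ 2); last by ring.
  by rewrite ler_wpM2r ?exprn_ge0.
have y_gt0 : 0 < y by lra.
rewrite ler_pdivrMr ?exprn_gt0 // [leRHS]mulrAC ler_pdivlMr //.
lra.
Qed.

(** * Limits superior and inferior as eventual bounds *)

Lemma limn_esup_lt (R : realType) (u : nat -> R) (b : \bar R) :
  (limn_esup (fun N => (u N)%:E) < b)%E ->
  exists2 c : R, (c%:E < b)%E & \forall N \near \oo, u N <= c.
Proof.
rewrite /limn_esup limf_esupE => /ereal_inf_lt[_ [V V_oo <-]] Vb.
have uV N : V N -> ((u N)%:E <= ereal_sup ((fun N => (u N)%:E) @` V))%E.
  by move=> VN; apply: ereal_sup_ubound; exists N.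
(* The supremum over the tail set [V] is the required constant: it is not [+oo], being below [b],
   nor [-oo], as [V] is inhabited. *)
move: Vb uV; case: (ereal_sup _) => [c||] cb uV.
- by exists c => //; apply: filterS V_oo => N /uV; rewrite lee_fin.
- by move: cb; rewrite ltNge leey.
- have [m _ Vm] := V_oo; have := uV m (Vm m (leqnn m)).
  by rewrite leNgt ltNyr.
Qed.

Lemma limn_einf_gt0 (R : realType) (u : nat -> R) :
  (0 < limn_einf (fun N => (u N)%:E))%E ->
  exists2 c : R, 0 < c & \forall N \near \oo, c <= u N.
Proof.
rewrite /limn_einf lteNr oppe0.
move=> /(limn_esup_lt (u := fun N => - u N))[c c0 uc].
exists (- c); first by rewrite oppr_gt0 -lte_fin.
by apply: filterS uc => N; rewrite lerNl.
Qed.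

Lemma limn_einf_le (R : realType) (u : nat -> R) (c : R) :
  (\forall N \near \oo, u N <= c) -> (limn_einf (fun N => (u N)%:E) <= c%:E)%E.
Proof.
move=> uc; apply: le_trans (limn_einf_sup _) _.
rewrite /limn_esup limf_esupE.
apply: (@le_trans _ _ (ereal_sup ((fun N => (u N)%:E) @` [set N | u N <= c]))).
  by apply: ereal_inf_lbound; exists [set N | u N <= c].
by apply: ge_ereal_sup => _ [N /= uN <-]; rewrite lee_fin.
Qed.

(** * Poisson distribution functions *)

Section Poisson.
Variable R : realType.
Implicit Types (mu x : R).

Lemma poisson_cdf_sum mu x M : 0 < mu -> M%:R <= x < M.+1%:R ->
  poisson_cdf mu x = \sum_(0 <= k < M.+1) poisson_weight mu k.
Proof.
move=> mu0 /andP[Mx xM]; rewrite /poisson_cdf /poisson_prob mu0.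
have -> : [set k : nat | k%:R <= x] = `I_M.+1.
  apply/seteqP; split=> k /=.
    by move=> kx; rewrite -(ltr_nat R) (le_lt_trans kx).
  by rewrite ltnS -(ler_nat R) => /le_trans; apply.
rewrite esum_fset //=; last by move=> k _; rewrite lee_fin poisson_pmf_ge0.
rewrite -fsbig_ord /= sumEFin /= big_mkord; apply: eq_bigr => k _.
by rewrite /poisson_pmf mu0.
Qed.

Lemma poisson_cdf_lt0 mu x : 0 < mu -> x < 0 -> poisson_cdf mu x = 0.
Proof.
move=> mu0 x0; rewrite /poisson_cdf /poisson_prob mu0.
rewrite (_ : [set k : nat | k%:R <= x] = set0) ?esum_set0 //.
by apply/seteqP; split=> k //= kx; have := le_lt_trans kx x0; rewrite ltNge ler0n.
Qed.

Lemma continuous_poisson_weight k : continuous (fun mu => poisson_weight mu k).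
Proof.
move=> mu; apply: cvgM; first by apply: cvgMl; exact: exprn_continuous.
apply: (@cvg_comp _ _ _ (fun t : R => - t) expR).
  exact: opp_continuous.
exact: continuous_expR.
Qed.

End Poisson.

(** * Poisson limit of the triangle count when its mean converges *)

Section Limits.
Variables (R : realType) (p0 p1 : nat -> R) (S : forall N, {set 'I_N}).
Variables (L mu : R).
Hypotheses (p0_ge0 : forall N, 0 <= p0 N) (p01 : forall N, p0 N <= p1 N).
Hypothesis p1_le1 : forall N, p1 N <= 1.
Hypothesis L1 : 1 <= L.
Hypothesis p1_cvg0 : p1 @ \oo --> (0 : R).
Hypothesis x_le : \forall N \near \oo, N%:R * p0 N <= L.
Hypothesis y_le : \forall N \near \oo, #|S N|%:R * p1 N <= L.
Hypothesis w_le : \forall N \near \oo, #|S N|%:R * p0 N <= 1.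
Hypothesis mean_cvg : triangle_mean (p0 N) (p1 N) (S N) @[N --> \oo] --> mu.
Hypothesis mu_gt0 : 0 < mu.

(** Half of the tolerance goes to the Poisson approximation at the current mean, half to the
    continuity of the Poisson weight in the mean. *)
Lemma planted_pmf_cvg k :
  prob_planted (p0 N) (p1 N) (S N) (fun W => triangles R W == k%:R) @[N --> \oo]
  --> poisson_weight mu k.
Proof.
apply/cvgrPdist_le => eta eta0; have eta20 : 0 < eta / 2 by rewrite divr_gt0.
have [delta delta0 Hd] := planted_poisson k L1 eta20.
have : poisson_weight (triangle_mean (p0 N) (p1 N) (S N)) k @[N --> \oo]
    --> poisson_weight mu k.
  apply: (@cvg_comp _ _ _ _ (fun m => poisson_weight m k) _ _ _ mean_cvg).
  exact: continuous_poisson_weight.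
move=> /cvgrPdist_le /(_ _ eta20) near_weight.
move: p1_cvg0 => /cvgrPdist_le /(_ _ delta0) near_p1.
near=> N.
have pN : p1 N <= delta.
  have : `|0 - p1 N| <= delta by near: N.
  by rewrite sub0r normrN; apply: le_trans; exact: ler_norm.
have := Hd N (S N) (p0 N) (p1 N) (p0_ge0 N) (p01 N) (p1_le1 N) pN.
have xN : N%:R * p0 N <= L by near: N.
have yN : #|S N|%:R * p1 N <= L by near: N.
have wN : #|S N|%:R * p0 N <= 1 by near: N.
move=> /(_ xN yN wN) h1.
have h2 : `|poisson_weight mu k
  - poisson_weight (triangle_mean (p0 N) (p1 N) (S N)) k| <= eta / 2 by near: N.
rewrite [eta](splitr eta).
apply: le_trans
  (ler_distD (poisson_weight (triangle_mean (p0 N) (p1 N) (S N)) k) _ _) _.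
by rewrite lerD // distrC.
Unshelve. all: by end_near.
Qed.

(** At a fixed [x >= 0] both distribution functions are finite sums of point masses, up to the
    integer part of [x], so convergence of each mass suffices. *)
Lemma planted_cdf_cvg : cdf_cvg (fun N x =>
    prob_planted (p0 N) (p1 N) (S N) (fun W => triangles R W <= x))
  (poisson_cdf mu).
Proof.
move=> x _; have [x0|x0] := leP 0 x; last first.
  rewrite poisson_cdf_lt0 // (_ : (fun N => _) = fun=> 0); first exact: cvg_cst.
  apply/funext => N; rewrite prob_plantedE.
  rewrite -[RHS](graph_exp_cst (planted_edge (p0 N) (p1 N) (S N))).
  by apply: graph_exp_ext => W _; rewrite leNgt (lt_le_trans x0).
have xM := truncn_itv x0.
rewrite (poisson_cdf_sum mu_gt0 xM).
under eq_fun do rewrite (prob_planted_le_sum (p0 _) (p1 _) (S _) xM).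
apply: cvg_big => [|k _]; first exact: add_continuous.
exact: planted_pmf_cvg.
Qed.

End Limits.

(** * Asymptotic regimes *)

Section Regimes.
Variables (R : realType) (n : nat -> nat) (p0 p1 : nat -> R).
Hypotheses (p0_ge0 : forall N, 0 <= p0 N) (p0_lt_p1 : forall N, p0 N < p1 N).
Hypothesis p1_le1 : forall N, p1 N <= 1.
Hypothesis n_infty : (n N)%:R @[N --> \oo] --> (+oo : set_system R).
Hypothesis n_small : (n N)%:R / N%:R @[N --> \oo] --> (0 : R).

Local Notation x N := (N%:R * p0 N).
Local Notation y N := ((n N)%:R * p1 N).

Let p01 N : p0 N <= p1 N. Proof. exact: ltW. Qed.
Let p1_gt0 N : 0 < p1 N. Proof. exact: le_lt_trans (p0_lt_p1 N). Qed.
Let p0_le1 N : p0 N <= 1. Proof. exact: le_trans (p1_le1 N). Qed.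
Let x_ge0 N : 0 <= x N. Proof. by rewrite mulr_ge0. Qed.
Let y_ge0 N : 0 <= y N. Proof. by rewrite mulr_ge0 // ltW. Qed.

Let n_ge (A : R) : \forall N \near \oo, A <= (n N)%:R.
Proof. by move: n_infty => /cvgryPge. Qed.

Let n_ge6 : \forall N \near \oo, (6 <= n N)%N.
Proof. by apply: filterS (n_ge 6) => N; rewrite ler_nat. Qed.

Let n_le (e : R) : 0 < e -> \forall N \near \oo, (n N)%:R <= e * N%:R.
Proof.
move=> e0; move: n_small => /cvgrPdist_le /(_ _ e0) near_n; near=> N.
have N0 : 0 < N%:R :> R by rewrite ltr0n; near: N; exact: nbhs_infty_gt.
rewrite -ler_pdivrMr //; apply: (le_trans (ler_norm _)).
by rewrite -normrN -sub0r; near: N.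
Unshelve. all: by end_near.
Qed.

(** Since [n * p0] is [n / N] times [x], it vanishes in the limit when [x] is bounded. *)
Lemma planted_degree_le (C e : R) : 0 < e -> (\forall N \near \oo, x N <= C) ->
  \forall N \near \oo, (n N)%:R * p0 N <= e.
Proof.
move=> e0 xC; pose D := Num.max C 1.
have D0 : 0 < D by rewrite lt_max ltr01 orbT.
have nD := n_le (divr_gt0 e0 D0); near=> N.
have xD : x N <= D by rewrite le_max; apply/orP; left; near: N.
have nN : (n N)%:R <= e / D * N%:R by near: N.
apply: (le_trans (ler_wpM2r (p0_ge0 N) nN)).
rewrite (_ : e / D * N%:R * p0 N = e * (x N) / D); last by ring.
by rewrite ler_pdivrMr // ler_wpM2l // ltW.
Unshelve. all: by end_near.
Qed.

(** For a target [eta], the criterion is used with [A = 2 + c / eta], where [c / A] bounds the risk,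
    so that the risk is at most [eta]. *)
Lemma powerful_criterion :
  (forall A : R, 2 <= A -> \forall N \near \oo,
     [/\ (n N)%:R * p0 N <= 1, A <= y N, A * x N <= y N ^+ 2
       & A * (x N ^+ 4 * p0 N) <= y N ^+ 6]) ->
  asymptotically_powerful n p0 p1 (@triangles R).
Proof.
move=> crit; exists (fun N => triangle_threshold N (n N) (p0 N) (p1 N)).
apply/cvgrPdist_le => eta eta0; pose c : R := 2304 * 94.
have c0 : 0 < c by rewrite /c mulr_gt0 ?ltr0n.
have A2 : 2 <= 2 + c / eta by rewrite lerDl divr_ge0 ?ltW.
have critA := crit _ A2; near=> N.
rewrite sub0r normrN ger0_norm ?risk_ge0 //.
have [w1 Ay Ax Ax4] : [/\ (n N)%:R * p0 N <= 1, 2 + c / eta <= y N,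
    (2 + c / eta) * x N <= y N ^+ 2
  & (2 + c / eta) * (x N ^+ 4 * p0 N) <= y N ^+ 6] by near: N.
have n6 : (6 <= n N)%N by near: N.
apply: (le_trans (risk_small n6 (p0_ge0 N) (p0_lt_p1 N) (p1_le1 N) w1 A2 Ay Ax Ax4)).
rewrite -/c ler_pdivrMr ?(lt_le_trans _ A2) // mulrDr mulrCA divff ?gt_eqF //.
by rewrite mulr1 lerDr mulr_ge0 // ltW.
Unshelve. all: by end_near.
Qed.

(** As [y >= 1], its powers dominate [y], hence [A * C^4]; the exponent 4 is dictated by the term
    [x^4 * p0]. *)
Lemma bounded_degree_criterion (C A : R) N : 1 <= C -> 2 <= A -> x N <= C ->
  A * C ^+ 4 <= y N ->
  [/\ A <= y N, A * x N <= y N ^+ 2 & A * (x N ^+ 4 * p0 N) <= y N ^+ 6].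
Proof.
move=> C1 A2 xC Ay; have A0 : 0 <= A by lra.
have C0 : 0 <= C by lra.
have C4 : 1 <= C ^+ 4 by rewrite exprn_ege1.
have ACy : A <= y N by apply: le_trans Ay; rewrite ler_peMr.
have y1 : 1 <= y N by lra.
have yX i : (0 < i)%N -> y N <= y N ^+ i.
  by move=> i0; rewrite -[leLHS]expr1 ler_weXn2l.
split=> //.
  apply: le_trans (yX 2%N isT); apply: le_trans Ay; rewrite ler_wpM2l //.
  by apply: (le_trans xC); rewrite -[leLHS]expr1 ler_weXn2l.
apply: le_trans (yX 6%N isT); apply: le_trans Ay; rewrite ler_wpM2l //.
rewrite -[leRHS]mulr1; apply: ler_pM; rewrite ?exprn_ge0 ?x_ge0 //.
by rewrite lerXn2r ?nnegrE.
Qed.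

Lemma powerful_bounded_degree :
  (limn_esup (fun N => (x N)%:E) < +oo)%E -> y N @[N --> \oo] --> +oo ->
  asymptotically_powerful n p0 p1 (@triangles R).
Proof.
move=> /limn_esup_lt[C _ xC] /cvgryPge y_infty.
apply: powerful_criterion => A A2; pose D := Num.max C 1.
have D1 : 1 <= D by rewrite le_max lexx orbT.
have w1 := planted_degree_le ltr01 xC.
have yA := y_infty (A * D ^+ 4); near=> N.
have xD : x N <= D by rewrite le_max; apply/orP; left; near: N.
have yN : A * D ^+ 4 <= y N by near: N.
have wN : (n N)%:R * p0 N <= 1 by near: N.
by have [] := bounded_degree_criterion D1 A2 xD yN.
Unshelve. all: by end_near.
Qed.

(** Eventually [y^2 / x] exceeds [B] times both members of the maximum. The member 1 gives
    [B * x <= y^2]; cubing the inequality for the other gives [B^3 * x^5 / N <= y^6], that is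
    [B^3 * x^4 * p0 <= y^6]. *)
Lemma powerful_large_degree :
  (0 < limn_einf (fun N => (x N)%:E))%E ->
  (\forall N \near \oo, x N < N%:R / (n N)%:R) ->
  (fun N : nat => Num.max 1 ((x N / Num.sqrt N%:R) `^ (2 / 3)))
    =o_\oo (fun N : nat => y N ^+ 2 / x N) ->
  asymptotically_powerful n p0 p1 (@triangles R).
Proof.
move=> /limn_einf_gt0[c c0 cx] x_lt /eqoP small.
apply: powerful_criterion => A A2; have A0 : 0 < A by lra.
(* The first summand gives [A <= B]; the second gives [A^2 <= B * c <= B * x <= y^2], hence
   [A <= y]. *)
pose B := A + A ^+ 2 / c.
have B_A : A <= B by rewrite lerDl divr_ge0 ?sqr_ge0 ?ltW.
have B0 : 0 < B by exact: lt_le_trans B_A.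
have iB0 : 0 < B^-1 by rewrite invr_gt0.
have smallB : \forall N \near \oo,
    `|Num.max 1 ((x N / Num.sqrt N%:R) `^ (2 / 3))|
      <= B^-1 * `|y N ^+ 2 / x N| := small _ iB0.
near=> N.
have n0 : 0 < (n N)%:R :> R.
  by rewrite ltr0n (leq_trans (_ : 0 < 6)%N) //; near: N.
have N0 : 0 < N%:R :> R by rewrite ltr0n; near: N; exact: nbhs_infty_gt.
have cxN : c <= x N by near: N.
have x0 : 0 < x N by exact: lt_le_trans cxN.
have : `|Num.max 1 ((x N / Num.sqrt N%:R) `^ (2 / 3))|
  <= B^-1 * `|y N ^+ 2 / x N| by near: N.
set z := _ `^ _.
have max_ge0 : 0 <= Num.max 1 z by rewrite le_max ler01.
have ratio_ge0 : 0 <= y N ^+ 2 / x N by rewrite divr_ge0 ?sqr_ge0.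
rewrite (ger0_norm max_ge0) (ger0_norm ratio_ge0).
rewrite ge_max mulrC ler_pdivlMr // => /andP[B1 Bz].
rewrite ler_pdivlMr // in Bz.
have Bx : B * x N <= y N ^+ 2 by rewrite -ler_pdivlMr // -[leLHS]mul1r.
have z0 : 0 <= z by exact: powR_ge0.
have z3 : z ^+ 3 = x N ^+ 2 / N%:R.
  rewrite -powR_mulrn // -powRrM (_ : 2 / 3 * 3%:R = 2%:R); last by field.
  rewrite powR_mulrn ?divr_ge0 ?sqrtr_ge0 ?ltW // expr_div_n sqr_sqrtr //.
split.
(* Dividing by [N] and multiplying by [n] turns this into [n * p0 < 1]. *)
- have : x N < N%:R / (n N)%:R by near: N.
  rewrite ltr_pdivlMr // mulrAC -[X in _ < X -> _]mulr1 -mulrA ltr_pM2l //.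
  by rewrite mulrC => /ltW.
- rewrite -(@ler_pXn2r _ 2) ?nnegrE ?(ltW A0) //; apply: le_trans Bx.
  apply: (@le_trans _ _ (B * c)); last by rewrite ler_wpM2l // ltW.
  rewrite mulrDl -mulrA mulVf ?gt_eqF // mulr1 lerDr mulr_ge0 // ltW //.
- by apply: le_trans Bx; rewrite ler_wpM2r.
have : (z * B) ^+ 3 <= (y N ^+ 2 / x N) ^+ 3.
  by rewrite lerXn2r ?nnegrE ?mulr_ge0 ?invr_ge0 ?sqr_ge0 // ltW.
rewrite exprMn z3 expr_div_n ler_pdivlMr ?exprn_gt0 //.
rewrite -exprM; apply: le_trans.
have -> : x N ^+ 2 / N%:R * B ^+ 3 * x N ^+ 3 = B ^+ 3 * (x N ^+ 4 * p0 N).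
  by field; rewrite gt_eqF.
rewrite ler_wpM2r ?mulr_ge0 ?exprn_ge0 ?x_ge0 // (le_trans B_A) //.
by rewrite -[leLHS]expr1 ler_weXn2l //; lra.
Unshelve. all: by end_near.
Qed.

Lemma p1_le_small (delta C : R) N : C <= delta * (n N)%:R -> (6 <= n N)%N ->
  y N <= C -> p1 N <= delta.
Proof.
move=> Cn n6 yC; have n0 : 0 < (n N)%:R :> R by rewrite ltr0n (leq_trans _ n6).
by rewrite -(ler_pM2r n0) mulrC (le_trans yC).
Qed.

(** * Poisson limits at fixed [lambda0] and [lambda1] *)

Section FixedDegrees.
Variables (l0 l1 : R).
Hypotheses (x_l0 : \forall N \near \oo, x N = l0).
Hypothesis (y_l1 : \forall N \near \oo, y N = l1).
Hypothesis N2p0 : N%:R ^+ 2 * p0 N @[N --> \oo] --> +oo.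

(** [N^2 * p0] equals [N * x] and tends to infinity, so [x] is eventually positive; this makes the
    limiting Poisson parameters positive. *)
Let l0_gt0 : 0 < l0.
Proof.
move: N2p0 => /cvgryPgt /(_ 0) near_pos; near \oo => N.
have <- : x N = l0 by near: N.
have : 0 < N%:R ^+ 2 * p0 N by near: N.
by rewrite expr2 -mulrA; apply: contraTT; rewrite -!leNgt => /mulr_ge0_le0->.
Unshelve. all: by end_near.
Qed.

Let l1_ge0 : 0 <= l1.
Proof.
near \oo => N; have <- : y N = l1 by near: N.
exact: y_ge0.
Unshelve. all: by end_near.
Qed.

Let p1_cvg0 : p1 @ \oo --> (0 : R).
Proof.
apply/cvgrPdist_le => e e0; have nA := n_ge (l1 / e); near=> N.
rewrite sub0r normrN ger0_norm ?(ltW (p1_gt0 N)) //.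
apply: (@p1_le_small _ l1).
- by rewrite mulrC -ler_pdivrMr //; near: N.
- by near: N.
- by rewrite (_ : y N = l1) //; near: N.
Unshelve. all: by end_near.
Qed.

Let p0_cvg0 : p0 @ \oo --> (0 : R).
Proof.
apply: (squeeze_cvgr _ (cvg_cst 0) p1_cvg0).
by apply: nearW => N; rewrite p0_ge0 p01.
Qed.

Let x_cvg : x N @[N --> \oo] --> l0. Proof. exact: cvg_near_cst. Qed.
Let y_cvg : y N @[N --> \oo] --> l1. Proof. exact: cvg_near_cst. Qed.

Let x_le (C : R) : l0 <= C -> \forall N \near \oo, x N <= C.
Proof. by move=> lC; apply: filterS x_l0 => N ->. Qed.

Let w_cvg0 : (n N)%:R * p0 N @[N --> \oo] --> 0.
Proof.
apply/cvgrPdist_le => e e0.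
apply: filterS (planted_degree_le e0 (x_le (lexx _))) => N.
by rewrite sub0r normrN ger0_norm // mulr_ge0.
Qed.

(** Only [m * p] and [p] occur on the right, and their limits are known. *)
Let bin3_cube (m : nat) (p : R) :
  'C(m, 3)%:R * p ^+ 3 = (m%:R * p) * (m%:R * p - p) * (m%:R * p - 2 * p) / 6.
Proof.
have := natr_bin3 R m => h.
have -> : 'C(m, 3)%:R = m%:R * (m%:R - 1) * (m%:R - 2) / 6 :> R.
  by rewrite -h; field.
by field.
Qed.

Let bin3_cube_cvg (m : nat -> nat) (p : nat -> R) (l : R) :
  (m N)%:R * p N @[N --> \oo] --> l -> p @ \oo --> (0 : R) ->
  'C(m N, 3)%:R * p N ^+ 3 @[N --> \oo] --> l ^+ 3 / 6.
Proof.
move=> ml p_0; under eq_fun do rewrite bin3_cube.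
have -> : l ^+ 3 / 6 = l * (l - 0) * (l - 2 * 0) / 6 by field.
by apply: cvgMl; apply: cvgM; [apply: cvgM => //; apply: cvgB|
  apply: cvgB => //; apply: cvgMr].
Qed.

Lemma null_cdf_cvg : cdf_cvg (fun N t => prob_null (p0 N) (fun W : 'M[bool]_N =>
    triangles R W <= t)) (poisson_cdf (l0 ^+ 3 / 6)).
Proof.
have -> : (fun N t => prob_null (p0 N) (fun W : 'M[bool]_N => triangles R W <= t))
    = (fun N t => prob_planted (p0 N) (p1 N) (finset.set0 : {set 'I_N})
        (fun W => triangles R W <= t)).
  by apply/funext => N; apply/funext => t; rewrite (prob_null_planted _ (p1 N)).
apply: (@planted_cdf_cvg R p0 p1 (fun N => finset.set0) (Num.max 1 l0)) => //.
- by rewrite le_max lexx.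
- by apply: x_le; rewrite le_max lexx orbT.
- by apply: nearW => N; rewrite cards0 mul0r le_max ler01.
- by apply: nearW => N; rewrite cards0 mul0r ler01.
- under eq_fun do rewrite triangle_mean_null //.
  exact: (bin3_cube_cvg (m := id)).
- by rewrite divr_gt0 // exprn_gt0.
Qed.

Lemma planted_cdf_cvg_fixed (S : forall N : nat, {set 'I_N}) :
  (\forall N \near \oo, #|S N| = n N) ->
  cdf_cvg (fun N t => prob_planted (p0 N) (p1 N) (S N)
    (fun W : 'M[bool]_N => triangles R W <= t))
  (poisson_cdf ((l0 ^+ 3 + l1 ^+ 3) / 6)).
Proof.
move=> Sn; pose L := Num.max 1 (Num.max l0 l1).
have w1 := planted_degree_le ltr01 (x_le (lexx _)).
apply: (@planted_cdf_cvg R p0 p1 S L) => //.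
- by rewrite le_max lexx.
- by apply: x_le; rewrite !le_max lexx orbT.
- near=> N; rewrite (_ : #|S N| = n N); last by near: N.
  by rewrite (_ : y N = l1) ?le_max ?lexx ?orbT //; near: N.
- by near=> N; rewrite (_ : #|S N| = n N); near: N.
(* The mean is squeezed between [m] and [m + x * y * (n * p0)]; the mixed term and the part of [m]
   in [n * p0] vanish in the limit. *)
- pose m N := 'C(N, 3)%:R * p0 N ^+ 3
    + ('C(n N, 3)%:R * p1 N ^+ 3 - 'C(n N, 3)%:R * p0 N ^+ 3).
  have m_cvg : m N @[N --> \oo] --> (l0 ^+ 3 + l1 ^+ 3) / 6.
    have -> : (l0 ^+ 3 + l1 ^+ 3) / 6
        = l0 ^+ 3 / 6 + (l1 ^+ 3 / 6 - 0 ^+ 3 / 6) by field.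
    apply: cvgD; first exact: (bin3_cube_cvg (m := id)).
    by apply: cvgB; exact: bin3_cube_cvg.
  have u_cvg : m N + x N * y N * ((n N)%:R * p0 N) @[N --> \oo]
      --> (l0 ^+ 3 + l1 ^+ 3) / 6.
    rewrite -[X in _ --> X]addr0 -[X in _ --> _ + X](mulr0 (l0 * l1)).
    by apply: cvgD => //; apply: cvgM => //; apply: cvgM.
  apply: squeeze_cvgr m_cvg u_cvg; near=> N.
  have SN : #|S N| = n N by near: N.
  have := triangle_mean_ge (S N) (p0_ge0 N) (p01 N).
  have := triangle_mean_le (S N) (p0_ge0 N) (p01 N) (p1_le1 N).
  rewrite SN !mulrBr /m => h1 h2; rewrite h2 /=; apply: (le_trans h1).
  by rewrite le_eqVlt; apply/orP; left; apply/eqP; ring.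
- by rewrite divr_gt0 // ltr_pwDl ?exprn_gt0 ?exprn_ge0.
Unshelve. all: by end_near.
Qed.

End FixedDegrees.

(** The threshold is chosen separately for each [N], by the size of [y]: that of the Chebyshev
    argument, or 1. In both cases the risk is at most [1 - 2 * eta], which keeps its limit inferior
    below 1. *)
Lemma not_powerless :
  (limn_esup (fun N => (x N)%:E) < +oo)%E ->
  (0 < limn_einf (fun N => (y N)%:E))%E ->
  ~ asymptotically_powerless n p0 p1 (@triangles R).
Proof.
move=> /limn_esup_lt[C0 _ xC0] /limn_einf_gt0[c c0 cy].
pose C := Num.max C0 1; have C1 : 1 <= C by rewrite le_max lexx orbT.
have Cge0 : 0 <= C by lra.
(* With this value the bound of [risk_small] is [1 / 2]. *)
pose A : R := 2 * (2304 * 94).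
have A2 : 2 <= A by rewrite /A; lra.
pose K := Num.max C (A * C ^+ 4).
have CK : C <= K by rewrite le_max lexx.
have K1 : 1 <= K by exact: le_trans CK.
(* A lower bound, uniform in [N], for the gap between the two means when [y >= c]. *)
pose g := c ^+ 3 / 24; have g0 : 0 < g by rewrite divr_gt0 ?exprn_gt0.
(* The Poisson approximations of [P(T = 0)] gain at least [4 * eta] over risk 1, as the null mean is
   at most [C^3]; their two errors lose [2 * eta]. *)
pose eta := expR (- C ^+ 3) * (1 - expR (- g)) / 4.
have eg1 : expR (- g) < 1 by rewrite -expR0 ltr_expR oppr_lt0.
have eta0 : 0 < eta by rewrite divr_gt0 // mulr_gt0 ?expR_gt0 ?subr_gt0.
have eta1 : eta <= 1 / 4.
  rewrite ler_wpM2r // -[leRHS]mulr1; apply: ler_pM; rewrite ?expR_ge0 //.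
  - by rewrite subr_ge0 ltW.
  - by rewrite -expR0 ler_expR oppr_le0 exprn_ge0.
have [delta delta0 Hd] := planted_poisson 0 K1 eta0.
pose t N : R := if A * C ^+ 4 <= y N
  then triangle_threshold N (n N) (p0 N) (p1 N) else 1.
suff risk_t : \forall N \near \oo,
    risk (n N) (p0 N) (p1 N) (threshold_test (@triangles R N) (t N)) <= 1 - 2 * eta.
  move=> /(_ t) powerless; have := le_trans powerless (limn_einf_le risk_t).
  by rewrite lee_fin; lra.
have w1 := planted_degree_le ltr01 xC0.
have c20 : 0 < c / 2 by rewrite divr_gt0.
(* Together with [c <= y], the bound [n * p0 <= c / 2] yields [2 * p0 <= p1], as the gap between the
   means requires. *)
have wc := planted_degree_le c20 xC0.
have nK := n_ge (K / delta).
near=> N.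
have n6 : (6 <= n N)%N by near: N.
have wN : (n N)%:R * p0 N <= 1 by near: N.
have xC : x N <= C by rewrite le_max; apply/orP; left; near: N.
rewrite /t; case: ifP => [yA|/negbT]; last rewrite -ltNge => yA.
  have [Ay Ax Ax4] := bounded_degree_criterion C1 A2 xC yA.
  apply: (le_trans (risk_small n6 (p0_ge0 N) (p0_lt_p1 N) (p1_le1 N) wN A2 Ay Ax Ax4)).
  apply: (@le_trans _ _ (1 / 2)); last by lra.
  by rewrite /A; lra.
have yK : y N <= K by rewrite le_max (ltW yA) orbT.
have pd : p1 N <= delta.
  by apply: p1_le_small yK => //; rewrite mulrC -ler_pdivrMr //; near: N.
have xK : x N <= K by exact: le_trans CK.
pose m0 := 'C(N, 3)%:R * p0 N ^+ 3.
have m0C : m0 <= C ^+ 3.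
  apply: (@le_trans _ _ (x N ^+ 3)); last by rewrite lerXn2r ?nnegrE.
  by rewrite exprMn ler_wpM2r ?exprn_ge0 ?bin3_le.
have weight0 m : poisson_weight m 0 = expR (- m) :> R.
  by rewrite /poisson_weight expr0 fact0 divr1 mul1r.
have null0 : expR (- m0) - eta <=
    prob_planted (p0 N) (p1 N) (finset.set0 : {set 'I_N})
      (fun W => triangles R W == 0).
  have := Hd N finset.set0 (p0 N) (p1 N) (p0_ge0 N) (p01 N) (p1_le1 N) pd xK.
  rewrite cards0 !mul0r triangle_mean_null // weight0 -/m0 ler_distl.
  by move=> /(_ (le_trans ler01 K1) ler01) /andP[].
have test0 (W : 'M[bool]_N) :
    threshold_test (@triangles R N) 1 W = (triangles R W != 0).
  by rewrite /threshold_test /triangles pnatr_eq0 -lt0n ler1n.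
(* Rejecting when a triangle exists errs with probability [1 - P(T = 0)] under the null law and
   [P(T = 0)] under the planted one, whose mean is at least [m0 + g]. *)
apply: le_trans (_ : _ <= (1 - (expR (- m0) - eta)) + (expR (- (m0 + g)) + eta)) _.
  apply: risk_le.
  - by rewrite addr_ge0 ?expR_ge0 ?ltW.
  - rewrite (prob_null_planted _ (p1 N)).
    rewrite (@prob_planted_eq _ _ _ _ _ _ (fun W => ~~ (triangles R W == 0))) => [|W _].
      by rewrite prob_plantedC lerD2l lerN2.
    exact: test0.
  move=> S Sn.
  rewrite (@prob_planted_eq _ _ _ _ _ _ (fun W => triangles R W == 0)); last first.
    by move=> W _; rewrite test0 negbK.
  have := Hd N S (p0 N) (p1 N) (p0_ge0 N) (p01 N) (p1_le1 N) pd xK.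
  rewrite Sn => /(_ yK wN); rewrite weight0 ler_distl => /andP[_ hS].
  apply: (le_trans hS); rewrite lerD2r ler_expR lerN2.
  have cN : c <= y N by near: N.
  have p2 : 2 * p0 N <= p1 N.
    have n0 : 0 < (n N)%:R :> R by rewrite ltr0n (leq_trans _ n6).
    rewrite -(ler_pM2l n0); apply: le_trans cN.
    have : (n N)%:R * p0 N <= c / 2 by near: N.
    by lra.
  apply: le_trans (triangle_mean_gap (p0_ge0 N) (p01 N) _ p2); last by rewrite Sn.
  by rewrite lerD2l Sn ler_wpM2r // lerXn2r ?nnegrE ?y_ge0 // ltW.
rewrite (opprD m0) expRD.
have e1 : expR (- C ^+ 3) <= expR (- m0) by rewrite ler_expR lerN2.
have : eta * 4 <= expR (- m0) * (1 - expR (- g)).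
  by rewrite mulfVK // ler_wpM2r // subr_ge0 ltW.
lra.
Unshelve. all: by end_near.
Qed.

End Regimes.

Theorem proposition4 (R : realType) (n : nat -> nat) (p0 p1 : nat -> R)
    (p0_ge0 : forall N : nat, 0 <= p0 N)
    (p0_lt_p1 : forall N : nat, p0 N < p1 N)
    (p1_le1 : forall N : nat, p1 N <= 1)
    (n_infty : (n N)%:R @[N --> \oo] --> (+oo : set_system R))
    (n_small : (n N)%:R / N%:R @[N --> \oo] --> (0 : R))
    (n_log : (n N)%:R / ln (N%:R : R) @[N --> \oo] --> +oo)
    (N2p0 : N%:R ^+ 2 * p0 N @[N --> \oo] --> +oo)
    (n2p1 : (n N)%:R ^+ 2 * p1 N @[N --> \oo] --> +oo) :
  let lambda0 : nat -> R := fun N => N%:R * p0 N in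
  let lambda1 : nat -> R := fun N => (n N)%:R * p1 N in
  [/\ (limn_esup (fun N => (lambda0 N)%:E) < +oo)%E ->
      lambda1 N @[N --> \oo] --> +oo ->
      asymptotically_powerful n p0 p1 (@triangles R),

      (0 < limn_einf (fun N => (lambda0 N)%:E))%E ->
      (\forall N \near \oo, lambda0 N < N%:R / (n N)%:R) ->
      (fun N : nat => Num.max 1 ((lambda0 N / Num.sqrt N%:R) `^ (2 / 3)))
        =o_\oo (fun N : nat => lambda1 N ^+ 2 / lambda0 N) ->
      asymptotically_powerful n p0 p1 (@triangles R),

      forall l0 l1 : R,
      (\forall N \near \oo, lambda0 N = l0) ->
      (\forall N \near \oo, lambda1 N = l1) ->
      cdf_cvg (fun N x => prob_null (p0 N) (fun W : 'M[bool]_N =>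
                 triangles R W <= x))
              (poisson_cdf (l0 ^+ 3 / 6)) /\
      (forall S : forall N : nat, {set 'I_N},
       (\forall N \near \oo, #|S N| = n N) ->
       cdf_cvg (fun N x => prob_planted (p0 N) (p1 N) (S N)
                  (fun W : 'M[bool]_N => triangles R W <= x))
               (poisson_cdf ((l0 ^+ 3 + l1 ^+ 3) / 6))) &

      (limn_esup (fun N => (lambda0 N)%:E) < +oo)%E ->
      (0 < limn_einf (fun N => (lambda1 N)%:E))%E ->
      ~ asymptotically_powerless n p0 p1 (@triangles R)].
Proof.
move=> lambda0 lambda1; split.
- exact: powerful_bounded_degree.
- exact: powerful_large_degree.
- move=> l0 l1 x_l0 y_l1; split; first exact: null_cdf_cvg x_l0 y_l1 _.
  by move=> S; exact: planted_cdf_cvg_fixed.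
- exact: not_powerless.
Qed.
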